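(* Let $(M^{2n+1},\eta)$ be a contact manifold ($n\geq 1$) endowed with a nearly cosymplectic structure $(\phi,\xi,\eta,g)$ (with the same $1$-form $\eta$), and let $D=\ker\eta$. Suppose there exist $p\in M$ and $c\in\mathbb{R}$ such that the sectional curvature of $g$ satisfies $K_p(\pi)=c$ for each $2$-plane $\pi$ of $D_p$. Then $c\neq 0$ and $\dim M=5$.
   Context: A contact manifold $(M^{2n+1},\eta)$ is a smooth manifold of dimension $2n+1$ with a $1$-form $\eta$ such that $\eta\wedge(d\eta)^n\neq 0$ everywhere. Its contact distribution is $D=\ker\eta\subset TM$, with fiber $D_p$ at $p$. An almost contact metric structure $(\phi,\xi,\eta,g)$ on $M^{2n+1}$ consists of a $(1,1)$-tensor field $\phi$, a vector field $\xi$, a $1$-form $\eta$ and a Riemannian metric $g$ with $\phi^2=-I+\eta\otimes\xi$, $\eta(\xi)=1$ and $g(\phi X,\phi Y)=g(X,Y)-\eta(X)\eta(Y)$ for all $X,Y$. It is called nearly cosymplectic if $(\nabla_X\phi)X=0$ for all vector fields $X$, where $\nabla$ is the Levi-Civita connection of $g$. *)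

(* Defs.v *)
From HB Require Import structures.
From mathcomp Require Import all_boot all_order all_algebra all_fingroup.
From mathcomp Require Import all_classical all_reals all_analysis.
From mathcomp Require Import ring.

Set Implicit Arguments.
Unset Strict Implicit.
Unset Printing Implicit Defensive.

Import Order.TTheory GRing.Theory Num.Theory.
Import numFieldNormedType.Exports.

Local Open Scope classical_set_scope.
Local Open Scope ring_scope.

Section Calculus.
Context {R : realType}.

Fixpoint Ck {V W : normedModType R} (k : nat) (U : set V) (f : V -> W) : Prop :=
  match k with
  | 0 => forall x, U x -> {for x, continuous f}
  | k'.+1 => (forall x, U x -> differentiable f x) /\
             (forall v : V, Ck k' U ('D_v f))
  end.

(* For finite-dimensional V this is the usual C^infinity on the open set U.     *)
Definition smooth {V W : normedModType R} (U : set V) (f : V -> W) : Prop :=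
  forall k, Ck k U f.

End Calculus.

Section Forms.
Context {R : realType} {V : lmodType R}.

Definition kform (k : nat) : Type := ('I_k -> V) -> R.

Definition wedge k l (a : kform k) (b : kform l) : kform (k + l)%N := fun v =>
  ((k`! * l`!)%N%:R)^-1 *
  \sum_(s : 'S_(k + l)%N) (-1) ^+ s *
     (a (fun i => v (s (lshift l i))) * b (fun j => v (s (rshift k j)))).

Fixpoint wedge_pow k (a : kform k) (n : nat) : kform (n * k)%N :=
  match n with
  | 0 => fun=> 1
  | n'.+1 => wedge a (@wedge_pow k a n')
  end.

End Forms.

Arguments wedge_pow {R V k} a n.

(* Tangent vectors, in the coordinates of a chart, are row vectors; a (1,1)    *)
(* tensor F acts by u |-> u *m F, a covector w by u |-> (u *m w^T) 0 0, and    *)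
(* the differential of a map f at x by u |-> u *m 'J f x.                      *)

Section Manifolds.
Context {R : realType} {d : nat} {M : topologicalType}.

(* cinv is the inverse homeomorphism; the values of cfun outside cdom and of   *)
(* cinv outside cimg are irrelevant.                                           *)
Record chart := Chart {
  cdom : set M;
  cimg : set 'rV[R]_d;
  cfun : M -> 'rV[R]_d;
  cinv : 'rV[R]_d -> M;
  cdom_open : open cdom;
  cimg_open : open cimg;
  cfun_img : forall p, cdom p -> cimg (cfun p);
  cinv_dom : forall x, cimg x -> cdom (cinv x);
  cfunK : forall p, cdom p -> cinv (cfun p) = p;
  cinvK : forall x, cimg x -> cfun (cinv x) = x;
  cfun_cont : forall p, cdom p -> {for p, continuous cfun};
  cinv_cont : forall x, cimg x -> {for x, continuous cinv}
}.

Definition overlap (c c' : chart) : set 'rV[R]_d :=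
  [set x | cimg c x /\ cdom c' (cinv c x)].

Definition transition (c c' : chart) (x : 'rV[R]_d) : 'rV[R]_d :=
  cfun c' (cinv c x).

Record smooth_manifold := SmoothManifold {
  chart_index : Type;
  chart_at :> chart_index -> chart;
  chart_cover : forall p, exists i, cdom (chart_at i) p;
  transition_smooth : forall i j,
    smooth (overlap (chart_at i) (chart_at j))
           (transition (chart_at i) (chart_at j));
  manifold_hausdorff : hausdorff_space M;
  manifold_second_countable : @second_countable M
}.

End Manifolds.

Arguments cdom_open {R d M} c.
Arguments cimg_open {R d M} c.
Arguments chart R d M : clear implicits.
Arguments smooth_manifold R d M : clear implicits.

(* A tensor field is the family of its component functions in the charts, each *)
(* a function on the image of the chart, subject to the tensorial change of    *)
(* coordinates on overlaps.                                                    *)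

Section Fields.
Context {R : realType} {d : nat} {M : topologicalType}.
Variable A : smooth_manifold R d M.

Record vector_field := VectorField {
  vf :> chart_index A -> 'rV[R]_d -> 'rV[R]_d;
  vf_smooth : forall i, smooth (cimg (A i)) (vf i);
  vf_change : forall i j x, overlap (A i) (A j) x ->
    vf j (transition (A i) (A j) x) = vf i x *m 'J (transition (A i) (A j)) x
}.

Record one_form := OneForm {
  of_ :> chart_index A -> 'rV[R]_d -> 'rV[R]_d;
  of_smooth : forall i, smooth (cimg (A i)) (of_ i);
  of_change : forall i j x, overlap (A i) (A j) x ->
    of_ i x = of_ j (transition (A i) (A j) x) *m
              ('J (transition (A i) (A j)) x)^T
}.

Record tensor11 := Tensor11 {
  t11 :> chart_index A -> 'rV[R]_d -> 'M[R]_d;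
  t11_smooth : forall i, smooth (cimg (A i)) (t11 i);
  t11_change : forall i j x, overlap (A i) (A j) x ->
    t11 i x *m 'J (transition (A i) (A j)) x =
    'J (transition (A i) (A j)) x *m t11 j (transition (A i) (A j) x)
}.

Definition bil (G : 'M[R]_d) (u v : 'rV[R]_d) : R := (u *m G *m v^T) 0 0.

Definition app (w u : 'rV[R]_d) : R := (u *m w^T) 0 0.

Record riemannian_metric := RiemannianMetric {
  rm :> chart_index A -> 'rV[R]_d -> 'M[R]_d;
  rm_smooth : forall i, smooth (cimg (A i)) (rm i);
  rm_change : forall i j x, overlap (A i) (A j) x ->
    rm i x = 'J (transition (A i) (A j)) x *m
             rm j (transition (A i) (A j) x) *m
             ('J (transition (A i) (A j)) x)^T;
  rm_sym : forall i x u v, cimg (A i) x -> bil (rm i x) u v = bil (rm i x) v u;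
  rm_pos : forall i x u, cimg (A i) x -> u != 0 -> 0 < bil (rm i x) u u
}.

(* d(eta)(X, Y) = X eta(Y) - Y eta(X) - eta([X, Y]), with X and Y the constant *)
(* coordinate fields u and v.                                                  *)
Definition ext_d (w : 'rV[R]_d -> 'rV[R]_d) (x u v : 'rV[R]_d) : R :=
  'D_u (fun y => app (w y) v) x - 'D_v (fun y => app (w y) u) x.

Definition contact_form (n : nat) (eta : one_form) : Prop :=
  forall i x, cimg (A i) x ->
    let e : kform 1 := fun s => app (eta i x) (s ord0) in
    let de : kform 2 := fun s => ext_d (eta i) x (s ord0) (s ord_max) in
    exists s, wedge e (wedge_pow de n) s != 0.

Record almost_contact_metric (phi : tensor11) (xi : vector_field)
    (eta : one_form) (g : riemannian_metric) : Prop := AlmostContactMetric {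
  acm_phi2 : forall i x u, cimg (A i) x ->
    u *m phi i x *m phi i x = - u + app (eta i x) u *: xi i x;
  acm_eta_xi : forall i x, cimg (A i) x -> app (eta i x) (xi i x) = 1;
  acm_compat : forall i x u v, cimg (A i) x ->
    bil (g i x) (u *m phi i x) (v *m phi i x) =
    bil (g i x) u v - app (eta i x) u * app (eta i x) v
}.

Definition lie_bracket (X Y : 'rV[R]_d -> 'rV[R]_d) (x : 'rV[R]_d) : 'rV[R]_d :=
  'D_(X x) Y x - 'D_(Y x) X x.

(* Connection coefficients on a coordinate domain: C x a b k is the symbol     *)
(* \Gamma^k_{ab}, i.e. the k-th component of the covariant derivative of the   *)
(* b-th coordinate field along the a-th one.                                   *)
Definition coefficients : Type := 'rV[R]_d -> 'I_d -> 'M[R]_d.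

Definition covd (C : coefficients) (X Y : 'rV[R]_d -> 'rV[R]_d) (x : 'rV[R]_d)
    : 'rV[R]_d :=
  'D_(X x) Y x + \sum_(a < d) X x 0 a *: (Y x *m C x a).

(* Torsion-free and metric. These two conditions determine the coefficients in *)
(* each chart, so their smoothness and their behaviour under a change of chart *)
(* need not be required; they exist by christoffel_levi_civita below.           *)
Record levi_civita (g : riemannian_metric) (nabla : chart_index A -> coefficients)
    : Prop := LeviCivita {
  lc_torsion : forall i (X Y : 'rV[R]_d -> 'rV[R]_d) x,
    smooth (cimg (A i)) X -> smooth (cimg (A i)) Y -> cimg (A i) x ->
    covd (nabla i) X Y x - covd (nabla i) Y X x = lie_bracket X Y x;
  lc_metric : forall i (X Y Z : 'rV[R]_d -> 'rV[R]_d) x,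
    smooth (cimg (A i)) X -> smooth (cimg (A i)) Y -> smooth (cimg (A i)) Z ->
    cimg (A i) x ->
    'D_(X x) (fun y => bil (g i y) (Y y) (Z y)) x =
    bil (g i x) (covd (nabla i) X Y x) (Z x) +
    bil (g i x) (Y x) (covd (nabla i) X Z x)
}.

Definition covd_endo (C : coefficients) (F : 'rV[R]_d -> 'M[R]_d)
    (X Y : 'rV[R]_d -> 'rV[R]_d) (x : 'rV[R]_d) : 'rV[R]_d :=
  covd C X (fun y => Y y *m F y) x - covd C X Y x *m F x.

Definition nearly_cosymplectic (nabla : chart_index A -> coefficients)
    (phi : tensor11) : Prop :=
  forall (X : vector_field) i x, cimg (A i) x ->
    covd_endo (nabla i) (phi i) (X i) (X i) x = 0.

Definition curvature (C : coefficients) (X Y Z : 'rV[R]_d -> 'rV[R]_d)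
    : 'rV[R]_d -> 'rV[R]_d := fun x =>
  covd C X (covd C Y Z) x - covd C Y (covd C X Z) x -
  covd C (lie_bracket X Y) Z x.

(* The curvature being tensorial, tangent vectors are extended to constant     *)
(* coordinate fields.                                                          *)
Definition sectional (G : 'M[R]_d) (C : coefficients) (x u v : 'rV[R]_d) : R :=
  bil G (curvature C (cst u) (cst v) (cst v) x) u /
  (bil G u u * bil G v v - bil G u v ^+ 2).

(* The 2-planes of ker eta at p, given by a basis (u, v) in the coordinates of *)
(* an arbitrary chart around p.                                                *)
Definition sectional_on_ker (g : riemannian_metric)
    (nabla : chart_index A -> coefficients) (eta : one_form) (p : M) (c : R)
    : Prop :=
  forall i (u v : 'rV[R]_d), cdom (A i) p ->
    let x := cfun (A i) p in
    app (eta i x) u = 0 -> app (eta i x) v = 0 -> free [:: u; v] ->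
    sectional (g i x) (nabla i) x u v = c.

End Fields.

Section Existence.
Context {R : realType} {d : nat} {M : topologicalType}.
Variable A : smooth_manifold R d M.

Definition christoffel (g : riemannian_metric A) (i : chart_index A) : coefficients :=
  fun x a => 2^-1 *: (\matrix_(b, l) ('D_(delta_mx 0 a) (g i) x b l
     + 'D_(delta_mx 0 b) (g i) x a l - 'D_(delta_mx 0 l) (g i) x a b)) *m invmx (g i x).

Lemma diff_entry m n (V : normedModType R) (F : V -> 'M[R]_(m, n)) x i j : differentiable F x ->
  differentiable (fun y => F y i j) x.
Proof. move=> h; have h2 := @differentiable_coord R m n (F x) i j.
exact: (differentiable_comp h h2). Qed.

Lemma derive_entry m n (V : normedModType R) (F : V -> 'M[R]_(m, n)) x v i j : differentiable F x ->
  ('D_v F x) i j = 'D_v (fun y => F y i j) x.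
Proof.
move=> h.
have h2 := diff_entry i j h.
rewrite !deriveE //.
pose c := (fun N : 'M[R]_(m,n) => N i j).
have hc N : differentiable c N := differentiable_coord N i j.
have -> : (fun y => F y i j) = c \o F by [].
rewrite (@diff_comp _ _ _ _ F c x) //.
have lc : linear c by move=> k a b; rewrite /c !mxE.
pose C := GRing.isLinear.Build _ _ _ _ _ lc.
pose cl : {linear 'M[R]_(m,n) -> R} := HB.pack c C.
have := @diff_lin R _ _ cl (F x); rewrite /= => -> //.
by move=> N; apply: differentiable_continuous; exact: hc.
Qed.

Lemma derive_dir (W : normedModType R) (F : 'rV[R]_d -> W) x v : differentiable F x ->
  'D_v F x = \sum_a v 0 a *: 'D_(delta_mx 0 a) F x.
Proof.
move=> h; rewrite deriveE // {1}(row_sum_delta v) linear_sum; apply: eq_bigr => a _.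
by rewrite linearZ deriveE.
Qed.

Lemma g_tr (g : riemannian_metric A) i x : cimg (A i) x -> (g i x)^T = g i x.
Proof.
move=> hx; apply/matrixP => a b; rewrite !mxE.
have := rm_sym g (delta_mx 0 a) (delta_mx 0 b) hx.
by rewrite /bil -!rowE !trmx_delta -!colE !mxE.
Qed.

Lemma g_unit (g : riemannian_metric A) i x : cimg (A i) x -> g i x \in unitmx.
Proof.
move=> hx; rewrite -row_free_unit -kermx_eq0; apply/eqP/row_matrixP => k; rewrite row0.
apply/eqP/negPn/negP => h; have := rm_pos g hx h; rewrite /bil.
have /sub_kermxP -> : (row k (kermx (g i x)) <= kermx (g i x))%MS by apply: row_sub.
by rewrite mul0mx mxE ltxx.
Qed.

Lemma Dg_sym (g : riemannian_metric A) i x v a b : cimg (A i) x ->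
  'D_v (g i) x a b = 'D_v (g i) x b a.
Proof.
move=> hx; have [dg _] := @rm_smooth _ _ _ _ g i 1.
rewrite !derive_entry; try exact: dg.
have [->|v0] := eqVneq v 0; first by rewrite !derive0.
apply: near_eq_derive => //.
near=> y.
have hy : cimg (A i) y.
  by near: y; apply: open_nbhs_nbhs; split; [exact: (cimg_open (A i))|exact: hx].
by rewrite -{1}(g_tr g hy) mxE.
Unshelve. all: by end_near.
Qed.

Lemma christoffelP (g : riemannian_metric A) i x a : cimg (A i) x ->
  christoffel g i x a *m g i x + g i x *m (christoffel g i x a)^T =
  'D_(delta_mx 0 a) (g i) x.
Proof.
move=> hx; have gu := g_unit g hx.
have S k b c := @Dg_sym g i x (delta_mx 0 k) b c hx.
rewrite /christoffel trmx_mul trmx_inv g_tr // mulmxKV // mulKVmx //.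
move: S; set D := fun k : 'I_d => 'D_(delta_mx 0 k) (g i) x => S.
have {}S k b c : D k b c = D k c b by exact: S.
rewrite -/(D a); apply/matrixP => b c; rewrite !mxE -!/(D _).
move: D S => D S; rewrite -mulrDr; apply: (mulfI (x := 2)) => //.
rewrite mulrA divff // mul1r (S a c b) (S b a c) (S c a b); ring.
Qed.

Lemma christoffel_sym (g : riemannian_metric A) i x a b : cimg (A i) x ->
  row b (christoffel g i x a) = row a (christoffel g i x b).
Proof.
move=> hx; rewrite /christoffel !row_mul; congr (_ *m _).
apply/rowP => l; rewrite !mxE (@Dg_sym g i x _ a b) //; congr (_ * _); ring.
Qed.

Lemma christoffel_levi_civita (g : riemannian_metric A) : levi_civita g (christoffel g).
Proof.
split.
  move=> i X Y x sX sY hx; rewrite /covd /lie_bracket.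
  suff -> : \sum_(a < d) X x 0 a *: (Y x *m christoffel g i x a) =
    \sum_(a < d) Y x 0 a *: (X x *m christoffel g i x a).
    by rewrite opprD addrACA subrr addr0.
  have E (u v : 'rV[R]_d) : \sum_(a < d) u 0 a *: (v *m christoffel g i x a) =
     \sum_(a < d) \sum_(b < d) (u 0 a * v 0 b) *: row b (christoffel g i x a).
    apply: eq_bigr => a _; rewrite mulmx_sum_row scaler_sumr.
    by apply: eq_bigr => b _; rewrite scalerA.
  rewrite !E exchange_big; apply: eq_bigr => a _; apply: eq_bigr => b _.
  by rewrite christoffel_sym // mulrC.
move=> i X Y Z x sX sY sZ hx.
have [dY _] := sY 1%N; have [dZ _] := sZ 1%N.
have [dg _] := @rm_smooth _ _ _ _ g i 1.
have {dY}dY := dY _ hx; have {dZ}dZ := dZ _ hx; have {dg}dg := dg _ hx.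
set v := X x.
have -> : 'D_v (fun y => bil (g i y) (Y y) (Z y)) x =
  bil (g i x) ('D_v Y x) (Z x) + bil (g i x) (Y x) ('D_v Z x) + bil ('D_v (g i) x) (Y x) (Z x).
  have E G (u w : 'rV[R]_d) : bil G u w = \sum_c \sum_b u 0 b * G b c * w 0 c.
    rewrite /bil mxE; apply: eq_bigr => c _; rewrite mxE mulr_suml mxE.
    by apply: eq_bigr => b _.
  rewrite !E -!big_split /=.
  have D m n (F : 'rV[R]_d -> 'M[R]_(m, n)) k l : differentiable F x -> derivable (fun y => F y k l) x v.
    by move=> dF; apply: diff_derivable; apply: diff_entry.
  have DD c b : is_derive x v (fun y => Y y 0 b * g i y b c * Z y 0 c)
     ('D_v Y x 0 b * g i x b c * Z x 0 c + Y x 0 b * g i x b c * 'D_v Z x 0 c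
      + Y x 0 b * 'D_v (g i) x b c * Z x 0 c).
    have h1 := derivableP (D _ _ _ 0 b dY).
    have h2 := derivableP (D _ _ _ b c dg).
    have h3 := derivableP (D _ _ _ 0 c dZ).
    rewrite -!derive_entry // in h1 h2 h3.
    have h4 := @is_deriveM _ _ _ _ _ _ _ _ (@is_deriveM _ _ _ _ _ _ _ _ h1 h2) h3.
    apply: is_derive_eq h4 _; rewrite /= /GRing.scale /=.
    rewrite (_ : ((fun y : 'rV_d => Y y 0 b) * (fun y : 'rV_d => g i y b c)) x = Y x 0 b * g i x b c) //.
    ring.
  have -> : (fun y => bil (g i y) (Y y) (Z y)) =
     \sum_c \sum_b (fun y => Y y 0 b * g i y b c * Z y 0 c).
    apply/funext => y; rewrite E fct_sumE; apply: eq_bigr => c _; by rewrite fct_sumE.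
  rewrite derive_sum; last first.
    move=> c; apply: derivable_sum => b; exact: (@ex_derive _ _ _ _ _ _ _ (DD c b)).
  apply: eq_bigr => c _; rewrite derive_sum; last by move=> b; exact: (@ex_derive _ _ _ _ _ _ _ (DD c b)).
  rewrite -!big_split /=; apply: eq_bigr => b _; exact: (@derive_val _ _ _ _ _ _ _ (DD c b)).
rewrite /covd -/v {2}/bil.
rewrite (derive_dir _ dg).
have bDl G (u1 u2 w : 'rV[R]_d) : bil G (u1 + u2) w = bil G u1 w + bil G u2 w.
  by rewrite /bil !mulmxDl mxE.
have bDr G (u1 u2 w : 'rV[R]_d) : bil G w (u1 + u2) = bil G w u1 + bil G w u2.
  by rewrite /bil linearD mulmxDr mxE.
rewrite -/(bil _ _ _) bDl bDr addrACA -addrA -addrA; congr (_ + (_ + _)).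
rewrite /bil mulmx_sumr !mulmx_suml linear_sum mulmx_sumr !summxE -big_split; apply: eq_bigr => a _ /=.
rewrite -christoffelP //; move: (christoffel g i x a) => C.
have -> : (v 0 a *: (Z x *m C))^T = v 0 a *: (C^T *m (Z x)^T) by rewrite linearZ /= trmx_mul.
by rewrite -!scalemxAr -!scalemxAl mulmxDr mulmxDl !mulmxA scalerDr mxE.
Qed.

End Existence.

(* Main.v *)
(* All the work is at the point p. Write P(x,y) = (nabla_x phi) y and h x = nabla_x xi. The nearly
   cosymplectic identity makes P, and its covariant derivative, totally skew. Differentiating
   phi^2 = - I + eta (x) xi once gives that h is skew, anticommutes with phi and that
   P(xi,y) = phi h y; since d eta (x,y) = 2 g(h x, y), the contact condition makes h injective on D.
   Differentiating twice, the Ricci identity and the first Bianchi identity force g(P(x,y), h z) = 0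
   for x, y, z in D, so that P(x,y) is a multiple of xi. When the curvature on D is constant, the
   Ricci identity also determines nabla^2 phi on D, and the twice differentiated identity becomes
     g(phi h x, y)^2 + g(h x, y)^2 = c (|x|^2 |y|^2 - g(x,y)^2 - g(phi x, y)^2).
   Taking y = h x gives c > 0; hence a y orthogonal to xi, x, phi x, h x and phi h x vanishes, and
   these five vectors form an orthogonal frame. Vector fields being global, the pointwise form of
   the nearly cosymplectic identity needs a smooth bump function. *)

From HB Require Import structures.
Require Import Defs.
From mathcomp Require Import all_boot all_order all_algebra all_fingroup.
From mathcomp Require Import all_classical all_reals all_analysis.
From mathcomp Require Import ring lra.
Set Implicit Arguments.
Unset Strict Implicit.
Unset Printing Implicit Defensive.
Import Order.TTheory GRing.Theory Num.Theory.
Import numFieldNormedType.Exports.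
Local Open Scope classical_set_scope.
Local Open Scope ring_scope.

(** * Tensor algebra at a point *)

(** Five comes from comparing ranks. For fixed nonzero x in D, the right side of the last identity
    is c |x|^2 times the squared length of the part of y orthogonal to x and phi x, a form of rank
    dim D - 2 on D; the left side has rank 2, so dim D = 4. The left side has rank 2 only once
    P(x,y) is known to be a multiple of xi: before that it is |P(x,y)|^2 + g(h x,y)^2. The crux is
    thus g(P(x,y), h z) = 0, and the obstacle there is the unknown derivative of h. As xi is
    Killing, the D-part of (nabla_z h) y is that of R(z, xi) y, so that this unknown can be
    eliminated from the Ricci identity involving the direction xi. The algebra is stated for an
    abstract inner product space whose data satisfy the differentiated identities; the analysis
    proves these identities in one chart. It needs two derivatives of phi, xi and g and one of the
    connection coefficients. [levi_civita] says nothing about the regularity of the latter, which is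
    obtained by identifying them with the Christoffel symbols. *)

Section PointwiseAlgebra.
Context {R : realFieldType} {V : lmodType R}.

(** In S_3, (12)(23)(12) = (23)(12)(23); the left word changes the sign of [f] and the right one
    does not. This is the argument behind the uniqueness of the Levi-Civita connection. *)
Lemma sym12_skew23_eq0 (f : V -> V -> V -> R) (D : V -> Prop) :
  (forall x y z, D x -> D y -> D z -> f x y z = f y x z) ->
  (forall x y z, D x -> D y -> D z -> f x y z = - f x z y) ->
  forall x y z, D x -> D y -> D z -> f x y z = 0.
Proof.
move=> s12 s23 x y z hx hy hz.
have := s12 x y z hx hy hz; have := s12 x z y hx hz hy; have := s12 y z x hy hz hx.
have := s23 x y z hx hy hz; have := s23 y x z hy hx hz; have := s23 z x y hz hx hy.
lra.
Qed.

Variables (g : V -> V -> R).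
Hypothesis gDl : forall x y z, g (x + y) z = g x z + g y z.
Hypothesis gZl : forall a x z, g (a *: x) z = a * g x z.
Hypothesis gC : forall x y, g x y = g y x.
Hypothesis gpos : forall x, x != 0 -> 0 < g x x.

Let g0l x : g 0 x = 0. Proof. by rewrite -(scale0r 0) gZl mul0r. Qed.
Let g0r x : g x 0 = 0. Proof. by rewrite gC g0l. Qed.
Let gNl x y : g (- x) y = - g x y. Proof. by rewrite -scaleN1r gZl mulN1r. Qed.
Let gNr x y : g x (- y) = - g x y. Proof. by rewrite gC gNl gC. Qed.
Let gDr x y z : g z (x + y) = g z x + g z y.
Proof. by rewrite gC gDl !(gC z). Qed.
Let gZr a x z : g z (a *: x) = a * g z x.
Proof. by rewrite gC gZl gC. Qed.
Let g_eq x y : (forall z, g x z = g y z) -> x = y.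
Proof.
move=> h; apply/eqP; rewrite -subr_eq0; apply/eqP/eqP/negPn/negP => /gpos.
by rewrite gDl gNl h subrr ltxx.
Qed.

(** * Algebraic curvature tensors with constant sectional curvature on a subspace *)

Section Curvature.
Variables (r : V -> V -> V -> V -> R) (D : V -> Prop).
Hypothesis DD : forall x y, D x -> D y -> D (x + y).
Hypothesis rDl : forall x x' y z w, r (x + x') y z w = r x y z w + r x' y z w.
Hypothesis r12 : forall x y z w, r x y z w = - r y x z w.
Hypothesis r34 : forall x y z w, r x y z w = - r x y w z.
Hypothesis rB : forall x y z w, r x y z w + r y z x w + r z x y w = 0.

Lemma curvature_pair_symmetry x y z w : r x y z w = r z w x y.
Proof.
have := rB x y z w; have := rB y z w x; have := rB z w x y; have := rB w x y z.
have := r34 x y z w; have := r34 y z x w; have := r34 z x y w.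
have := r34 z w x y; have := r34 w y x z; have := r34 w x y z.
have := r12 x y z w; have := r12 y z x w; have := r12 z x y w.
have := r12 z w x y; have := r12 w y x z; have := r12 w x y z.
have := r34 x w z y; have := r34 x z w y; have := r34 y w x z; have := r34 y w z x.
have := r34 y z w x; have := r34 w x z y; have := r34 w y z x.
have := r12 y w z x; have := r12 y w x z.
have := r34 z x w y; have := r12 z x w y.
lra.
Qed.

Variable c : R.
Hypothesis rK : forall u v, D u -> D v -> r u v v u = c * (g u u * g v v - g u v ^+ 2).

(** The defect [e] has the symmetries of [r] and satisfies [e u v v u = 0] on D. Polarising in [u]
    and then in [v] makes it skew in the middle pair, hence totally skew on D, where the Bianchi
    identity becomes 3 e = 0. Every vector used in the polarisation stays in D, the domain of
    [rK]. *)
Lemma constant_curvature x y z w : D x -> D y -> D z -> D w ->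
  r x y z w = c * (g y z * g x w - g x z * g y w).
Proof.
pose e x y z w := r x y z w - c * (g y z * g x w - g x z * g y w).
have e12 a b u v : e a b u v = - e b a u v by rewrite /e (r12 a); ring.
have e34 a b u v : e a b u v = - e a b v u by rewrite /e (r34 a); ring.
have eB a b u v : e a b u v + e b u a v + e u a b v = 0.
  rewrite /e -[RHS](rB a b u v) (gC u a) (gC b a) (gC u b); ring.
have eP a b u v : e a b u v = e u v a b.
  by rewrite /e curvature_pair_symmetry (gC b u) (gC a v) (gC a u) (gC b v); ring.
have eD a a' b u v : e (a + a') b u v = e a b u v + e a' b u v.
  by rewrite /e rDl !gDl; ring.
have e0 a b : D a -> D b -> e a b b a = 0.
  by move=> ha hb; rewrite /e rK // (gC b a); ring.
have eD2 a b b' u v : e a (b + b') u v = e a b u v + e a b' u v.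
  by rewrite e12 eD opprD -!e12.
have eD3 a b u u' v : e a b (u + u') v = e a b u v + e a b u' v.
  by rewrite eP eD !(eP _ _ a).
have eD4 a b u v v' : e a b u (v + v') = e a b u v + e a b u v'.
  by rewrite eP eD2 !(eP _ _ a).
have e0' a b v : D a -> D b -> D v -> e a b b v = 0.
  move=> ha hb hv; have := e0 _ b (DD ha hv) hb; rewrite eD !eD4 !e0 // (eP v) e12 e34; lra.
have e23 a b u v : D a -> D b -> D u -> D v -> e a b u v = - e a u b v.
  move=> ha hb hu hv; have := e0' a (b + u) v ha (DD hb hu) hv.
  rewrite eD2 !eD3 !e0' //; lra.
move=> hx hy hz hw; apply/eqP; rewrite -subr_eq0 -/(e x y z w); apply/eqP.
have := eB x y z w; have := e23 x y z w hx hy hz hw; have := e12 z x y w.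
have := e23 y z x w hy hz hx hw; have := e12 x y z w; have := e12 y x z w; have := e12 x z y w.
lra.
Qed.

End Curvature.

(* In the application, at a point: [P x y] is (nabla_x phi) y, [h x] is nabla_x xi, [H z x y] is
   (nabla^2_{z,x} phi) y, [M z x] is (nabla_z h) x and [Rm] is the curvature; [Pph] and [Hph] are
   the first two covariant derivatives of phi^2 = - I + eta (x) xi. *)
Section NearlyCosymplecticPoint.
Variables (ph h : V -> V) (xi : V).
Hypothesis ph0 : ph 0 = 0.
Hypothesis phN : forall x, ph (- x) = - ph x.
Hypothesis ph2 : forall x, ph (ph x) = - x + g x xi *: xi.
Hypothesis phxi : ph xi = 0.
Hypothesis gxi : g xi xi = 1.
Hypothesis gph : forall x y, g (ph x) y = - g x (ph y).

Variables P : V -> V -> V.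
Hypothesis P0 : forall x, P x 0 = 0.
Hypothesis PN : forall x y, P x (- y) = - P x y.
Hypothesis PC : forall x y, P x y = - P y x.
Hypothesis gP : forall x y z, g (P x y) z = - g y (P x z).
Hypothesis Pph : forall x y, P x (ph y) + ph (P x y) = g (h x) y *: xi + g y xi *: h x.

Let D x := g x xi = 0.

Let D_ph x : D (ph x). Proof. by rewrite /D gph phxi g0r oppr0. Qed.

Let ph2D x : D x -> ph (ph x) = - x.
Proof. by move=> hx; rewrite ph2 hx scale0r addr0. Qed.

Let gphph x y : D x -> g (ph x) (ph y) = g x y.
Proof. by move=> hx; rewrite gC gph gC ph2D // gNl opprK. Qed.

Let gxx_ph x : g x (ph x) = 0.
Proof. by have := gph x x; rewrite (gC (ph x)); lra. Qed.

(** [Pph] at [y = xi] gives [h x] plus a multiple of [xi]. The image of [ph] is orthogonal to [xi],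
    so pairing with [xi] shows that the coefficient [g (h x) xi] vanishes; this also yields
    [D_h]. *)
Let phP_xi x : ph (P x xi) = h x.
Proof.
have := Pph x xi; rewrite phxi P0 add0r gxi scale1r => e.
have := congr1 (g^~ xi) e; rewrite D_ph gDl gZl gxi => e0.
by rewrite e (_ : g (h x) xi = 0) ?scale0r ?add0r //; lra.
Qed.

Let D_h x : D (h x). Proof. by rewrite -phP_xi; exact: D_ph. Qed.

Let P_xi x : P xi x = ph (h x).
Proof.
rewrite PC -phP_xi ph2 (_ : g (P x xi) xi = 0) ?scale0r ?addr0 //.
by have := gP x xi xi; rewrite (gC xi); lra.
Qed.

Let h_xi : h xi = 0.
Proof.
rewrite -phP_xi; suff -> : P xi xi = 0 by [].
have e := PC xi xi.
apply: (@g_eq) => z; rewrite g0l; have := congr1 (g^~ z) e; rewrite gNl; lra.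
Qed.

Let h_ph x : h (ph x) = - ph (h x).
Proof.
have := Pph xi x; rewrite h_xi g0l scale0r scaler0 addr0 !P_xi (ph2D (D_h _)) => /eqP.
by rewrite subr_eq0 => /eqP <-; rewrite (ph2D (D_h _)) opprK.
Qed.

(** This says that xi is a Killing field. The operator [P xi], equal to [ph \o h], is skew; testing
    it against [ph y] transfers skewness to [h], which anticommutes with [ph]. *)
Lemma h_skew x y : g (h x) y = - g x (h y).
Proof.
have e := gP xi x (ph y); rewrite !P_xi (gphph _ (D_h _)) in e.
by rewrite e h_ph phN (ph2D (D_h _)) opprK.
Qed.

Let gphh x y : g (ph (h x)) y = - g x (ph (h y)).
Proof. by rewrite -!P_xi gP. Qed.

Let Tphm x y w : D x -> D y -> D w -> g (P x (ph y)) w = g (P x y) (ph w).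
Proof.
move=> hx hy hw; have /(congr1 (g^~ w)) := Pph x y.
rewrite hy scale0r addr0 gZl (gC xi) hw mulr0 gDl gph; lra.
Qed.

Let Tskew x y w : g (P x y) w = - g (P x w) y.
Proof. by rewrite gP gC. Qed.

Let TC x y w : g (P x y) w = - g (P y x) w.
Proof. by rewrite PC gNl. Qed.

Variables (H : V -> V -> V -> V) (M : V -> V -> V) (Rm : V -> V -> V -> V).
Hypothesis HC : forall z x y, H z x y = - H z y x.
Hypothesis gH : forall z x y w, g (H z x y) w = - g y (H z x w).
Hypothesis H0 : forall z x, H z x 0 = 0.
Hypothesis Rm0 : forall x y, Rm x y 0 = 0.
Hypothesis RmDl : forall x x' y z, Rm (x + x') y z = Rm x y z + Rm x' y z.
Hypothesis RmC : forall x y z, Rm x y z = - Rm y x z.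
Hypothesis gRm : forall x y z w, g (Rm x y z) w = - g z (Rm x y w).
Hypothesis RmB : forall x y z, Rm x y z + Rm y z x + Rm z x y = 0.
Hypothesis ricci : forall x y z, H x y z - H y x z = Rm x y (ph z) - ph (Rm x y z).
Hypothesis Hph : forall z x y,
  H z x (ph y) + P x (P z y) + P z (P x y) + ph (H z x y) =
  g (M z x) y *: xi + g (h x) y *: h z + g (h z) y *: h x + g y xi *: M z x.

Let r x y z w := g (Rm x y z) w.
Let rDl x x' y z w : r (x + x') y z w = r x y z w + r x' y z w.
Proof. by rewrite /r RmDl gDl. Qed.
Let r12 x y z w : r x y z w = - r y x z w.
Proof. by rewrite /r RmC gNl. Qed.
Let r34 x y z w : r x y z w = - r x y w z.
Proof. by rewrite /r gRm gC. Qed.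
Let rB x y z w : r x y z w + r y z x w + r z x y w = 0.
Proof. by rewrite /r -!gDl RmB g0l. Qed.

Let t x y z w := g (H x y z) w.
Let t23 x y z w : t x y z w = - t x z y w. Proof. by rewrite /t HC gNl. Qed.
Let t34 x y z w : t x y z w = - t x y w z. Proof. by rewrite /t gH gC. Qed.
Let t_ricci x y z w : t x y z w - t y x z w = r x y (ph z) w + r x y z (ph w).
Proof.
rewrite /t -gNl -gDl ricci gDl gNl gph /r; ring.
Qed.

Let Nh z x y := g (M z x) y.

(** The derivative of g(h x, xi) = 0, read off from the [xi] component of [Hph]. *)
Let gM_xi z x : g (M z x) xi = - g (h z) (h x).
Proof.
have e a b : g (P a (P b xi)) xi = - g (h b) (h a).
  by rewrite gP (PC b) (PC a) !P_xi !gNr !gNl (gphph _ (D_h _)); ring.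
have /(congr1 (g^~ xi)) := Hph z x xi.
rewrite phxi H0 add0r !gDl !gZl gxi D_ph D_h D_h !e (gC (h x)); lra.
Qed.

(** The Ricci identity for xi, extracted from that for phi: at the argument [xi], [Hph] expresses
    [M] through [H] up to terms that are symmetric in the two directions and therefore cancel. *)
Let ricci_xi z x w : Nh z x w - Nh x z w = r z x xi w.
Proof.
have e a b : t a b xi (ph w) = - (g (M a b) xi * g xi w + Nh a b w) + g (P b (P a xi)) w + g (P a (P b xi)) w.
  have /(congr1 (g^~ w)) := Hph a b xi.
  rewrite phxi H0 add0r gxi scale1r (D_h a) (D_h b) !scale0r !addr0 !gDl gZl gph -/(t a b xi (ph w)) -/(Nh a b w); lra.
have := t_ricci z x xi (ph w); rewrite !e phxi ph2 /r Rm0 g0l gDr gNr gZr !gM_xi (gC (h x)).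
have := gRm z x xi xi; rewrite (gC xi); nra.
Qed.

(** The aim is [Ts = 0] on D. The outer slots are skew and [ph] moves between slots with fixed signs
    ([Sph13], [Sph12]), so what follows is linear algebra over the permutations of three vectors. *)
Let Ts x z y := g (P x (h z)) y.

Let Sout x z y : Ts x z y = - Ts y z x.
Proof. by rewrite /Ts TC Tskew (TC y); ring. Qed.

Let Sph13 x z y : D x -> D y -> Ts (ph x) z y = Ts x z (ph y).
Proof.
by move=> hx hy; rewrite /Ts TC (Tphm (D_h z) hx hy) -TC.
Qed.

Let Sph12 x z y : D x -> D z -> D y -> Ts (ph x) z y = - Ts x (ph z) y.
Proof.
by move=> hx hz hy; rewrite Sph13 // /Ts h_ph PN gNl opprK (Tphm _ (D_h z)).
Qed.

Let Lxi z x w : D z -> D x -> D w -> t z xi x w = - Nh z x (ph w) + Ts x z w + Ts z x w.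
Proof.
move=> hz hx hw.
have /(congr1 (g^~ (ph w))) := Hph z x xi.
rewrite phxi H0 add0r gxi scale1r (D_h z) (D_h x) !scale0r !addr0 !gDl gZl (gC xi) D_ph.
rewrite mulr0 add0r gC (gC (P z _)) (gC (ph (H _ _ _))) (gphph _ hw) !(gC (ph w)) !(gC w).
rewrite (PC z xi) (PC x xi) !P_xi !PN !gNl.
have := Tphm hx (D_h z) (D_ph w); have := Tphm hz (D_h x) (D_ph w).
rewrite (ph2D hw) !gNr /Ts t23 -/(Nh z x (ph w)) -/(t z x xi w); lra.
Qed.

(* The covariant derivative of [h \o ph = - ph \o h]. *)
Let Nphph z y w : D z -> D y -> D w ->
  Nh z y w + Nh z (ph y) (ph w) = Ts (ph z) w y - Ts (ph z) y w.
Proof.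
move=> hz hy hw; have /(congr1 (g^~ w)) := Hph z xi y.
rewrite h_xi g0l scale0r scaler0 hy scale0r !addr0 !gDl gZl (gC xi w) hw mulr0.
rewrite !P_xi (gph (H z xi y)) -/(t z xi y (ph w)) -/(t z xi (ph y) w).
rewrite (Lxi hz (D_ph y) hw) (Lxi hz hy (D_ph w)) ph2D // /Nh gNr.
have f1 : g (ph (h (P z y))) w = Ts (ph z) w y.
  by rewrite gph h_skew opprK Tskew -/(Ts z (ph w) y) Sph12.
have f2 : g (P z (ph (h y))) w = Ts (ph z) y w by rewrite (Tphm hz (D_h y) hw) Sph13.
rewrite f1 f2; have := Sph13 z hy hw; have := Sph13 y hz hw; have := Sph12 hz hy hw.
have := Sout (ph y) z w; have := Sout y z (ph w); have := Sph13 z hw hy.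
have := Sout (ph w) z y; have := Sout z y (ph w); lra.
Qed.

Let NC z y w : D z -> D y -> D w -> Nh z y w = - Nh z w y.
Proof.
move=> hz hy hw; have e := t34 z xi y (ph w).
rewrite (Lxi hz hy (D_ph w)) (Lxi hz (D_ph w) hy) ph2D // in e.
have := Nphph hz hw hy; move: e; rewrite {1 2}/Nh gNr -/(Nh _ _ _) -/(Nh _ _ _).
have := Sph13 z hy hw; have := Sph13 y hz hw; have := Sph12 hz hw hy.
have := Sout (ph z) w y; have := Sout y z (ph w); have := Sout z y (ph w).
lra.
Qed.

Let Ncyc z y w : D z -> D y -> D w -> Nh z y w + Nh y w z + Nh w z y = 0.
Proof.
move=> hz hy hw; have := rB z y w xi; rewrite r34 (r34 y) (r34 w).
rewrite -!ricci_xi (NC hy hz) // (NC hw hy) // (NC hz hw) //; lra.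
Qed.

(** Kostant's identity for the Killing field xi, restricted to D. It makes the Ricci identity for
    the directions [z] and [xi] a relation between [t], [Ts] and [Nh] alone. *)
Let N_r z y w : D z -> D y -> D w -> r z xi y w = Nh z y w.
Proof.
move=> hz hy hw; rewrite (curvature_pair_symmetry r12 r34 rB) r34 -ricci_xi.
by have := Ncyc hz hy hw; rewrite (NC hw hz) //; lra.
Qed.

Let txi z y w : D z -> D y -> D w ->
  t xi z y w = 2 * Ts z y w + Ts y z w + Ts z w y - 3 * Nh z y (ph w).
Proof.
move=> hz hy hw; have := t_ricci z xi y w.
rewrite (Lxi hz hy hw) (N_r hz (D_ph _) hw) (N_r hz hy (D_ph _)).
have e := t34 z xi y w; rewrite (Lxi hz hy hw) (Lxi hz hw hy) in e.
have := NC hz (D_ph y) hw; have := Sout y z w; lra.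
Qed.

(** Eliminates [Nh] from [txi]. Exchanging the last two arguments gives two expressions, [k1] and
    [k2], of one quantity; written for all permutations of three vectors, together with the skewness
    and the cyclic sum of [Nh], they determine [t xi] from [Ts]. *)
Let txi_S z y w : D z -> D y -> D w -> t xi z y w = Ts z y w - Ts y z w.
Proof.
have k1 a b d : D a -> D b -> D d -> t xi a b (ph d) =
    2 * Ts a b (ph d) + Ts b a (ph d) - Ts a d (ph b) + 3 * Nh a b d.
  move=> ha hb hd; rewrite (txi ha hb (D_ph _)) ph2D // /Nh gNr.
  by have := Sph13 d ha hb; have := Sph12 ha hd hb; lra.
have k2 a b d : D a -> D b -> D d -> t xi a b (ph d) =
    2 * Ts a b (ph d) + Ts b a (ph d) - Ts a d (ph b) - 3 * Nh a d b.
  move=> ha hb hd; rewrite t34 (txi ha (D_ph d) hb).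
  have := Sph13 d ha hb; have := Sph12 ha hd hb; have := Sph13 b ha hd.
  have := Nphph ha hd hb; have := Sout (ph d) a b; lra.
have k3 a b d : D a -> D b -> D d -> t xi a b (ph d) = Ts a b (ph d) - Ts b a (ph d).
  move=> ha hb hd.
  have := Ncyc ha hb hd; have := NC ha hb hd; have := NC hb hd ha; have := NC hd ha hb.
  have := k1 _ _ _ ha hb hd; have := k1 _ _ _ hb hd ha; have := k1 _ _ _ hd ha hb.
  have := k1 _ _ _ hb ha hd; have := k1 _ _ _ hd hb ha; have := k1 _ _ _ ha hd hb.
  have := k2 _ _ _ ha hb hd; have := k2 _ _ _ hb hd ha; have := k2 _ _ _ hd ha hb.
  have := k2 _ _ _ hb ha hd; have := k2 _ _ _ hd hb ha; have := k2 _ _ _ ha hd hb.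
  have := t23 xi a b (ph d); have := t23 xi b d (ph a); have := t23 xi d a (ph b).
  have o u v e : D u -> D v -> D e -> Ts u v (ph e) = - Ts e v (ph u).
    by move=> hu hv he; rewrite Sout Sph13.
  have := o _ _ _ ha hb hd; have := o _ _ _ hb hd ha; have := o _ _ _ hd ha hb.
  lra.
move=> hz hy hw; have := k3 _ _ _ hz hy (D_ph w).
by rewrite ph2D // /t /Ts !gNr; lra.
Qed.

(* [txi_S] makes [Ts] totally skew, which its sign rules under [ph] forbid unless it vanishes. *)
Lemma P_h_eq0 z y w : D z -> D y -> D w -> g (P z y) (h w) = 0.
Proof.
have s a b d : D a -> D b -> D d -> Ts a b d = - Ts a d b.
  move=> ha hb hd; have := t34 xi a b d; rewrite !txi_S //.
  by have := Sout b a d; lra.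
move=> hz hy hw; rewrite Tskew -/(Ts z w y).
have e a b d : D a -> D b -> D d -> Ts (ph a) b d = 0.
  move=> ha hb hd; have := Sph12 ha hb hd; have := Sph13 b ha hd.
  have := s a _ d ha (D_ph b) hd; have := Sph13 d ha hb.
  have := s _ b d (D_ph a) hb hd; lra.
have := e _ w y (D_ph z) hw hy; rewrite ph2D // /Ts TC PN gNl opprK => e'.
by rewrite TC e' !oppr0.
Qed.

Variable c : R.
Hypothesis sec : forall u v, D u -> D v -> g (Rm u v v) u = c * (g u u * g v v - g u v ^+ 2).

Let om x y := g (ph x) y.
Let omC x y : om x y = - om y x. Proof. by rewrite /om gph (gC x). Qed.

Let omE x y : g x (ph y) = om y x. Proof. exact: gC. Qed.

(** The right side is skew in [y, z, w], and its alternation in [x, y] is what the Ricci identity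
    yields for curvature [c] on D. The defect [f] is then symmetric in its first two slots and skew
    in the last two. *)
Lemma second_derivative x y z w : D x -> D y -> D z -> D w ->
  g (H x y z) w = - c * (g x y * om z w + g x z * om w y + g x w * om y z).
Proof.
have DD a b : D a -> D b -> D (a + b) by rewrite /D gDl => -> ->; rewrite addr0.
have rE := constant_curvature DD rDl r12 r34 rB sec.
move=> hx hy hz hw.
pose f x y z := t x y z w + c * (g x y * om z w + g x z * om w y + g x w * om y z).
have f12 a b d : D a -> D b -> D d -> f a b d = f b a d.
  move=> ha hb hd; have := t_ricci a b d w; rewrite !rE //; try exact: D_ph.
  by rewrite /f !omE (gC b a) (omC b d) (omC a d); lra.
have f23 a b d : D a -> D b -> D d -> f a b d = - f a d b.
  by move=> ha hb hd; rewrite /f (t23 _ b) (omC w b) (omC b d) (omC d w); ring.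
have := sym12_skew23_eq0 f12 f23 hx hy hz; rewrite /f /t; lra.
Qed.

(** [Hph] with both directions equal to [x], paired with [y]: as [P x] is skew, the two quadratic
    terms add up to -2 |P(x,y)|^2, while [second_derivative] evaluates the terms in [H]. *)
Lemma norm_P x y : D x -> D y ->
  g (P x y) (P x y) + g (h x) y ^+ 2 = c * (g x x * g y y - g x y ^+ 2 - om x y ^+ 2).
Proof.
move=> hx hy; have /(congr1 (g^~ y)) := Hph x x y.
rewrite !gDl !gZl (gC xi y) hy mulr0 mul0r addr0 add0r gph !second_derivative //; try exact: D_ph.
rewrite omE /(om (ph y) y) /(om (ph y) x) !ph2D // !gNl /om (gphph _ hx) (gphph _ hy) -/(om x y) -/(om y x).
rewrite (omC y x) (gC y x) (gP x (P x y)); lra.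
Qed.

Lemma horizontal_identity (hsurj : forall z, D z -> exists2 w, D w & h w = z) x y :
  D x -> D y ->
  g (ph (h x)) y ^+ 2 + g (h x) y ^+ 2 = c * (g x x * g y y - g x y ^+ 2 - g (ph x) y ^+ 2).
Proof.
move=> hx hy; rewrite -norm_P //.
have -> : P x y = g (ph (h x)) y *: xi.
  (* Removing the [xi] part puts the test vector in D, hence in the image of [h], where [P_h_eq0]
     applies. *)
  apply: g_eq => z; have e : g (P x y) (z - g z xi *: xi) = 0.
    have [|w hw <-] := hsurj (z - g z xi *: xi).
      by rewrite /D gDl gNl gZl gxi mulr1 subrr.
    exact: P_h_eq0.
  have e2 : g (P x y) xi = g (ph (h x)) y by rewrite Tskew (PC x) gNl P_xi opprK.
  by move: e; rewrite gDr gNr gZr gZl e2 (gC z); lra.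
by rewrite gZl gZr gxi; ring.
Qed.

Let gxx_h x : g x (h x) = 0.
Proof. by have := h_skew x x; rewrite (gC (h x)); lra. Qed.

Let gxx_phh x : g x (ph (h x)) = 0.
Proof. by have := gphh x x; rewrite (gC (ph (h x))); lra. Qed.

Hypothesis hinj : forall z, D z -> h z = 0 -> z = 0.
(** Finite dimension enters the algebra as this implication. The operator is [h] corrected along
    [xi], because [h xi = 0] prevents [h] from being injective. *)
Hypothesis surj : (forall z, h z + g z xi *: xi = 0 -> z = 0) ->
  forall z, exists w, h w + g w xi *: xi = z.

Let hsurj z : D z -> exists2 w, D w & h w = z.
Proof.
move=> hz; have [w ew|w ew] := surj _ z.
  have e : D w by have := congr1 (g^~ xi) ew; rewrite gDl gZl gxi D_h g0l add0r mulr1.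
  by move: ew; rewrite e scale0r addr0; exact: hinj.
have e : D w by have := congr1 (g^~ xi) ew; rewrite gDl gZl gxi D_h hz add0r mulr1.
by exists w => //; rewrite -ew e scale0r addr0.
Qed.

Lemma curvature_gt0 x : D x -> x != 0 -> 0 < c.
Proof.
move=> hx x0; have := norm_P hx (D_h x).
rewrite gxx_h /om gph gxx_phh oppr0 expr0n /= !subr0.
have hx0 : h x != 0 by apply: contra_neq x0 => /hinj; exact.
have p1 := gpos x0; have p2 := gpos hx0.
have p3 : 0 <= g (P x (h x)) (P x (h x)).
  by have [->|/gpos/ltW//] := eqVneq (P x (h x)) 0; rewrite g0l.
move=> e; have : 0 < c * (g x x * g (h x) (h x)) by rewrite -e ltr_wpDl // exprn_gt0.
by rewrite pmulr_lgt0 // mulr_gt0.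
Qed.

Lemma orthogonal_eq0 x y : D x -> x != 0 ->
  g y xi = 0 -> g y x = 0 -> g y (ph x) = 0 -> g y (h x) = 0 -> g y (ph (h x)) = 0 -> y = 0.
Proof.
move=> hx x0 y1 y2 y3 y4 y5; have := horizontal_identity hsurj hx y1.
rewrite !(gC _ y) y2 y3 y4 y5 expr0n /= !subr0 addr0.
move=> /esym/eqP; rewrite !mulf_eq0 (gt_eqF (curvature_gt0 hx x0)) (gt_eqF (gpos x0)) /=.
by apply: contraTeq => /gpos/gt_eqF->.
Qed.

Lemma orthogonal_frame x : D x -> x != 0 ->
  let e := tnth [tuple xi; x; ph x; h x; ph (h x)] in
  [/\ forall i, e i != 0, forall i j, i != j -> g (e i) (e j) = 0 &
      forall y, (forall i, g y (e i) = 0) -> y = 0].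
Proof.
move=> hx x0 e.
have nz z : 0 < g z z -> z != 0 by apply: contraTneq => ->; rewrite g0l ltxx.
have hx0 : h x != 0 by apply: contra_neq x0 => /hinj; exact.
split.
- case=> [[|[|[|[|[|//]]]]]] i; apply: nz; rewrite /e (tnth_nth 0) /=.
  + by rewrite gxi ltr01.
  + exact: gpos.
  + by rewrite gphph // gpos.
  + exact: gpos.
  + by rewrite (gphph _ (D_h x)) gpos.
- have s (k : 'I_5 -> 'I_5 -> R) : (forall i j, k i j = k j i) ->
    (forall i j : 'I_5, (i < j)%N -> k i j = 0) -> forall i j, i != j -> k i j = 0.
    move=> kC kl i j; rewrite neq_lt => /orP[|] l; [exact: kl|rewrite kC; exact: kl].
  apply: s => [i j|]; first exact: gC.
  have a1 := gxx_h x; have a2 := gxx_phh x; have a3 := gxx_ph x; have a4 := gxx_ph (h x).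
  have a5 : g (ph x) (h x) = 0 by rewrite gph a2 oppr0.
  have a6 : g (ph x) (ph (h x)) = 0 by rewrite (gphph _ hx) gxx_h.
  have D1 := D_ph x; have D2 := D_h x; have D3 := D_ph (h x).
  by case=> [[|[|[|[|[|//]]]]]] i; case=> [[|[|[|[|[|//]]]]]] j // _;
    rewrite /e !(tnth_nth 0) /= // gC.
- move=> y hy.
  have He k (l : (k < 5)%N) := hy (Ordinal l); rewrite /e in He.
  by apply: (orthogonal_eq0 hx x0); [have := He 0%N isT|have := He 1%N isT|have := He 2%N isT
    |have := He 3%N isT|have := He 4%N isT]; rewrite (tnth_nth 0).
Qed.

End NearlyCosymplecticPoint.
End PointwiseAlgebra.

(** * Exterior forms *)

Section AlternatingForms.
Context {R : realType} {V : lmodType R}.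

Definition update k (v : 'I_k -> V) i p : 'I_k -> V := fun j => if j == i then p else v j.

Definition multilinear k (a : @kform R V k) := forall v i x p q,
  a (update v i (x *: p + q)) = x * a (update v i p) + a (update v i q).

Definition alternating k (a : @kform R V k) :=
  forall v i j, i != j -> v i = v j -> a v = 0.

Definition killed_by (z : V) k (a : @kform R V k) := forall v i, v i = z -> a v = 0.

Lemma wedge_killed z k l (a : @kform R V k) (b : @kform R V l) :
  killed_by z a -> killed_by z b -> killed_by z (wedge a b).
Proof.
move=> ha hb v i vi; rewrite /wedge big1 ?mulr0 // => s _.
(* The argument [v i] is fed to slot [s^-1 i], which belongs to exactly one of the two factors. *)
have := permKV s i; case: (split_ordP (s^-1 i)%g) => j -> sj.
  by rewrite (ha _ j) ?mul0r ?mulr0 // sj.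
by rewrite (hb _ j) ?mulr0 // sj.
Qed.

Lemma wedge_multilinear k l (a : @kform R V k) (b : @kform R V l) :
  multilinear a -> multilinear b -> multilinear (wedge a b).
Proof.
move=> ha hb v i x p q; rewrite /wedge [x * _]mulrCA -mulrDr; congr (_ * _).
rewrite mulr_sumr -big_split; apply: eq_bigr => s _ /=.
rewrite [x * _]mulrCA -mulrDr; congr (_ * _).
have := permKV s i; case: (split_ordP (s^-1 i)%g) => j -> sj.
- have e r : (fun t => update v i r (s (lshift l t))) = update (fun t => v (s (lshift l t))) j r.
    by apply/funext => t; rewrite /update -sj (inj_eq perm_inj) (inj_eq (@lshift_inj _ _)).
  have e' r : (fun t => update v i r (s (rshift k t))) = (fun t => v (s (rshift k t))).
    by apply/funext => t; rewrite /update -sj (inj_eq perm_inj) eq_rlshift.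
  by rewrite !e !e' ha mulrDl mulrA.
- have e r : (fun t => update v i r (s (rshift k t))) = update (fun t => v (s (rshift k t))) j r.
    by apply/funext => t; rewrite /update -sj (inj_eq perm_inj) (inj_eq (@rshift_inj _ _)).
  have e' r : (fun t => update v i r (s (lshift l t))) = (fun t => v (s (lshift l t))).
    by apply/funext => t; rewrite /update -sj (inj_eq perm_inj) eq_lrshift.
  by rewrite !e !e' hb mulrDr; congr (_ + _); rewrite mulrCA.
Qed.

(** The sum over the whole symmetric group antisymmetrises by itself: composing with the
    transposition of [i] and [j] keeps the arguments, since [v i = v j], and flips every sign. *)
Lemma wedge_alternating k l (a : @kform R V k) (b : @kform R V l) : alternating (wedge a b).
Proof.
move=> v i j ij vij; rewrite /wedge.
set S := \sum_s _; suff -> : S = 0 by rewrite mulr0.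
suff e : S = - S by move: e => /eqP; rewrite -addr_eq0 -mulr2n mulrn_eq0 => /eqP.
rewrite {1}/S (reindex_inj (mulIg (tperm i j))) -sumrN; apply: eq_bigr => s _ /=.
have vt x : v ((s * tperm i j)%g x) = v (s x).
  by rewrite permM; case: tpermP => [->|->|].
rewrite odd_permM odd_tperm ij signr_addb expr1 mulrN1 mulNr; congr (- (_ * (a _ * b _)));
  by apply/funext => t; rewrite vt.
Qed.

Lemma wedge_pow_killed z k (a : @kform R V k) n : killed_by z a -> killed_by z (wedge_pow a n).
Proof. by move=> ha; elim: n => [v []//|n IH]; exact: wedge_killed. Qed.

Lemma wedge_pow_multilinear k (a : @kform R V k) n : multilinear a -> multilinear (wedge_pow a n).
Proof. by move=> ha; elim: n => [v []//|n IH]; exact: wedge_multilinear. Qed.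

End AlternatingForms.

(** The degree is a variable of its own because the contact form has degree [1 + n * 2], which
    agrees with the dimension only after a rewriting. *)
Lemma top_form_killed_eq0 (R : realType) d m (a : @kform R 'rV[R]_d m) z : m = d ->
  multilinear a -> alternating a -> z != 0 -> killed_by z a -> forall v, a v = 0.
Proof.
move=> md; subst d => ml alt z0 az v.
pose A := \matrix_i v i.
(* [w] holds the coordinates of [z] if the [v i] form a basis, and otherwise a linear dependence
   between them; in both cases the combination annihilates [a] in any slot. Expanding it in a slot
   with [w 0 i != 0] leaves, by alternation, only [w 0 i * a v]. *)
have [w w0 aw] : exists2 w : 'rV_m, w != 0 & forall i, a (update v i (w *m A)) = 0.
  have [uA|] := boolP (A \in unitmx).
    exists (z *m invmx A) => [|i]; last by rewrite mulmxKV // (az _ i) // /update eqxx.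
    by apply: contra_neq z0 => e; rewrite -(mulmxKV uA z) e mul0mx.
  rewrite -row_free_unit -kermx_eq0 => /rowV0Pn[w /sub_kermxP wA w0]; exists w => // i.
  by rewrite wA; have := ml v i (-1) 0 0; rewrite scaler0 addr0 mulN1r addNr.
have [i wi] : exists i, w 0 i != 0.
  by apply/existsP; apply: contra_neqT w0 => /existsPn h; apply/rowP => i; rewrite mxE; apply/eqP/negPn.
have := aw i; rewrite mulmx_sum_row.
have sumE (r : seq 'I_m) : a (update v i (\sum_(j <- r) w 0 j *: row j A)) =
    \sum_(j <- r) w 0 j * a (update v i (v j)).
  elim: r => [|j r IH]; last by rewrite !big_cons ml IH rowK.
  by rewrite !big_nil; have := ml v i (-1) 0 0; rewrite scaler0 addr0 mulN1r addNr.
rewrite sumE (bigD1 i) //= big1 => [|j ji].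
  have -> : update v i (v i) = v by apply/funext => j; rewrite /update; case: eqP => [->|].
  by rewrite addr0 => /eqP; rewrite mulf_eq0 (negbTE wi) => /eqP.
by rewrite (alt _ i j) ?mulr0 // 1?eq_sym // /update eqxx (negbTE ji).
Qed.

Lemma contact_killed_eq0 (R : realType) d n (e : @kform R 'rV[R]_d 1) (de : @kform R 'rV[R]_d 2) z :
  d = (2 * n).+1 -> multilinear e -> multilinear de -> z != 0 -> killed_by z e -> killed_by z de ->
  forall v, wedge e (wedge_pow de n) v = 0.
Proof.
move=> dn me mde z0 ze zde; apply: top_form_killed_eq0 z0 _; first by rewrite dn mulnC.
- by apply: wedge_multilinear => //; exact: wedge_pow_multilinear.
- exact: wedge_alternating.
- by apply: wedge_killed => //; exact: wedge_pow_killed.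
Qed.

(** * Differential calculus *)

Section Differentiability.
Context {R : realType} {V : normedModType R}.

Lemma differentiable_eps (W : normedModType R) (f : V -> W) x : differentiable f x ->
  forall e, 0 < e -> \forall h \near 0, `|f (h + x) - f x - 'd f x h| <= e * `|h|.
Proof.
move=> /diff_locallyP[_ /eqaddoP H] e e0; near=> h.
have -> : f (h + x) - f x - 'd f x h = (f \o shift x - (cst (f x) + 'd f x)) h.
  by rewrite -addrA -opprD.
by near: h; exact: H.
Unshelve. all: by end_near. Qed.

Lemma differentiable_linear_eps (W : normedModType R) (f : V -> W) (L : {linear V -> W}) x :
  continuous L ->
  (forall e, 0 < e -> \forall h \near 0, `|f (h + x) - f x - L h| <= e * `|h|) ->
  differentiable f x.
Proof.
move=> cL H; have E : f \o shift x = cst (f x) + L +o_ 0 id.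
  apply/eqaddoP => e e0; near=> h.
  have -> : (f \o shift x - (cst (f x) + L)) h = f (h + x) - f x - L h.
    by rewrite -addrA -opprD.
  by near: h; exact: H.
by apply/diff_locallyP; rewrite (diff_unique cL E).
Unshelve. all: by end_near. Qed.

Lemma near_eq_differentiable (W : normedModType R) (f k : V -> W) x :
  (\near x, f x = k x) -> differentiable f x -> differentiable k x.
Proof.
move=> fk df; apply: (@differentiable_linear_eps _ _ ('d f x)).
  exact: diff_continuous.
move=> e e0; have fkx : f x = k x by exact: nbhs_singleton fk.
have fk' : \forall h \near 0, f (h + x) = k (h + x).
  have c : h + x @[h --> 0] --> x.
    by rewrite -[X in _ --> X]add0r; apply: cvgD; [exact: cvg_id|exact: cvg_cst].
  exact: c _ fk.
near=> h; rewrite -fkx; have <- : f (h + x) = k (h + x) by near: h.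
by near: h; exact: differentiable_eps.
Unshelve. all: by end_near. Qed.

Lemma differentiable_mx m n (F : V -> 'M[R]_(m, n)) x :
  (forall i j, differentiable (fun y => F y i j) x) -> differentiable F x.
Proof.
move=> H; have -> : F = \sum_i \sum_j (fun y => F y i j *: delta_mx i j).
  apply/funext => y; rewrite fct_sumE [LHS]matrix_sum_delta; apply: eq_bigr => i _.
  by rewrite fct_sumE.
by apply: differentiable_sum => i; apply: differentiable_sum => j; exact: differentiableZl.
Qed.

Lemma differentiable_trmx m n (F : V -> 'M[R]_(m, n)) x :
  differentiable F x -> differentiable (fun y => (F y)^T) x.
Proof.
move=> dF; apply: differentiable_mx => i j.
by under eq_fun do rewrite mxE; exact: diff_entry.
Qed.

Lemma derive_trmx m n (F : V -> 'M[R]_(m, n)) x v : differentiable F x ->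
  'D_v (fun y => (F y)^T) x = ('D_v F x)^T.
Proof.
move=> dF; apply/matrixP => i j; rewrite derive_entry ?mxE; last exact: differentiable_trmx.
by rewrite derive_entry //; under eq_fun do rewrite mxE.
Qed.

Lemma differentiable_mulmx m n p (F : V -> 'M[R]_(m, n)) (G : V -> 'M[R]_(n, p)) x :
  differentiable F x -> differentiable G x -> differentiable (fun y => F y *m G y) x.
Proof.
move=> dF dG; apply: differentiable_mx => i j.
have -> : (fun y => (F y *m G y) i j) = \sum_k ((fun y => F y i k) * (fun y => G y k j)).
  by apply/funext => y; rewrite fct_sumE mxE.
by apply: differentiable_sum => k; apply: differentiableM; exact: diff_entry.
Qed.

Lemma derive_mulmx m n p (F : V -> 'M[R]_(m, n)) (G : V -> 'M[R]_(n, p)) x v :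
  differentiable F x -> differentiable G x ->
  'D_v (fun y => F y *m G y) x = 'D_v F x *m G x + F x *m 'D_v G x.
Proof.
move=> dF dG; apply/matrixP => i j; rewrite derive_entry; last exact: differentiable_mulmx.
have -> : (fun y => (F y *m G y) i j) = \sum_k ((fun y => F y i k) * (fun y => G y k j)).
  by apply/funext => y; rewrite fct_sumE mxE.
have D a b c (E : V -> 'M[R]_(a, b)) k l : differentiable E c -> derivable (fun y => E y k l) c v.
  by move=> dE; apply: diff_derivable; apply: diff_entry.
rewrite derive_sum; last by move=> k; apply: derivableM; exact: D.
rewrite !mxE -big_split; apply: eq_bigr => k _ /=.
rewrite deriveM; try exact: D.
by rewrite /= !derive_entry // addrC; congr (_ + _); rewrite /GRing.scale /= mulrC.
Qed.

Lemma derive_dir_linear (W : normedModType R) (f : V -> W) x : differentiable f x ->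
  linear (fun v => 'D_v f x).
Proof. by move=> df a u v; rewrite !deriveE // linearP. Qed.

Lemma is_derive_line (W : normedModType R) (f : V -> W) a u (s : R) :
  differentiable f (s *: u + a) ->
  is_derive s 1 (fun s => f (s *: u + a)) ('D_u f (s *: u + a)).
Proof.
move=> df; have dl : is_diff s (fun s : R => s *: u + a) ( *:%R^~ u).
  by apply: is_diff_eq; rewrite addr0.
have dl' : differentiable (fun s : R => s *: u + a) s by have [] := dl.
have dc := @differentiable_comp _ _ _ _ (fun s : R => s *: u + a) f s dl' df.
apply: DeriveDef; first exact: diff_derivable dc.
rewrite deriveE // (_ : (fun s => f (s *: u + a)) = f \o (fun s : R => s *: u + a)) //.
rewrite diff_comp //.
by rewrite /= diff_val /= scale1r deriveE.
Qed.

(* Young's form of Schwarz's theorem: both mixed derivatives are the limit of the second difference quotient. *)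
Lemma second_difference (f : V -> R) (U : set V) x u v : open U -> U x ->
  (forall y, U y -> differentiable f y) -> differentiable ('D_u f) x ->
  forall e, 0 < e -> \forall t \near (0:R)^'+,
   `|f (t *: u + (t *: v + x)) - f (t *: u + x) - f (t *: v + x) + f x - t ^+ 2 * 'D_v ('D_u f) x|
     <= e * t ^+ 2.
Proof.
move=> oU Ux df d2 e e0.
(* The two remainders are bounded by e' |su + tv| and e' |su| with s < t, in total at most e' t
   (2|u| + |v|); the 1 keeps the divisor positive. *)
pose e' := e / (2 * `|u| + `|v| + 1).
have q0 : 0 < 2 * `|u| + `|v| + 1 by rewrite ltr_wpDl // addr_ge0 // mulr_ge0.
have e'0 : 0 < e' by rewrite divr_gt0.
have HU : \forall h \near (0 : V), U (h + x).
  have c : h + x @[h --> (0 : V)] --> x.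
    by rewrite -[X in _ --> X]add0r; apply: cvgD; [exact: cvg_id|exact: cvg_cst].
  by apply: (c U); apply: open_nbhs_nbhs.
have /nbhs_norm0P[dl /= dl0 Hd] : \forall h \near (0 : V), U (h + x) /\
   `|'D_u f (h + x) - 'D_u f x - 'd ('D_u f) x h| <= e' * `|h|.
  by apply: filterI; [exact: HU|exact: differentiable_eps].
have {}Hd h : `|h| < dl -> U (h + x) /\
   `|'D_u f (h + x) - 'D_u f x - 'd ('D_u f) x h| <= e' * `|h|.
  by move=> hd; exact: Hd.
near=> t; have t0 : 0 < t by [].
have tdl : t * (`|u| + `|v| + 1) < dl.
  rewrite -ltr_pdivlMr; last by rewrite ltr_wpDl // addr_ge0.
  by near: t; apply: nbhs_right_lt; rewrite divr_gt0 // ltr_wpDl // addr_ge0.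
(* The boolean tells whether the offset [t *: v] is present, so that one bound covers both points of
   evaluation. *)
have small s (b : bool) : 0 <= s <= t -> `|s *: u + (if b then t else 0) *: v| < dl.
  move=> /andP[s0 st]; apply: le_lt_trans tdl; apply: le_trans (ler_normD _ _) _.
  rewrite !normrZ ger0_norm // mulrDr mulrDr mulr1 -addrA lerD //.
    by rewrite ler_wpM2r.
  apply: (@le_trans _ _ (t * `|v|)); last by rewrite lerDl ltW.
  by rewrite ler_wpM2r //; case: b; rewrite ?normr0 ?ger0_norm // ltW.
(* The second difference is [phi t - phi 0]; the mean value theorem turns it into [t] times a
   difference of two values of ['D_u f], to which differentiability at [x] applies. *)
pose phi s := f (s *: u + (t *: v + x)) - f (s *: u + x).
have dphi s : 0 <= s <= t -> is_derive s 1 phi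
    ('D_u f (s *: u + (t *: v + x)) - 'D_u f (s *: u + x)).
  move=> hs; apply: is_deriveB.
    apply: is_derive_line; apply: df; rewrite addrA.
    by have [] := Hd _ (small s true hs).
  apply: is_derive_line; apply: df.
  by have [] := Hd _ (small s false hs); rewrite scale0r addr0.
have h1 s : s \in `]0, t[ -> is_derive s 1 phi
    ('D_u f (s *: u + (t *: v + x)) - 'D_u f (s *: u + x)).
  by rewrite in_itv /= => /andP[s0 st]; apply: dphi; rewrite !ltW.
have h2 : {within `[0, t], continuous phi}.
  apply: derivable_within_continuous => s; rewrite in_itv /= => hs.
  by have [] := dphi s hs.
have [s] := MVT t0 h1 h2.
rewrite in_itv /= subr0 => /andP[s0 st].
rewrite {1 2}/phi !scale0r !add0r.
have hs : 0 <= s <= t by rewrite !ltW.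
have LE a b : 'd ('D_u f) x (a *: u + b *: v) = a * 'D_u ('D_u f) x + b * 'D_v ('D_u f) x.
  by rewrite linearD /= !linearZ /= -!deriveE.
have [_] := Hd _ (small s true hs); have [_] := Hd _ (small s false hs).
rewrite !LE mul0r scale0r !addr0 -!(addrA _ _ x).
set A := 'D_u f (s *: u + x); set B := 'D_u f (s *: u + (t *: v + x)).
set L := s * _; set M := 'D_v _ x; set D := 'D_u f x => hA hB E.
have -> : f (t *: u + (t *: v + x)) - f (t *: u + x) - f (t *: v + x) + f x - t ^+ 2 * M =
    t * ((B - D - (L + t * M)) - (A - D - L)).
  have -> : f (t *: u + (t *: v + x)) - f (t *: u + x) - f (t *: v + x) + f x = (B - A) * t.
    by rewrite -E; ring.
  by ring.
rewrite normrM (gtr0_norm t0) (_ : e * t ^+ 2 = t * (e * t)); last by ring.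
rewrite ler_wpM2l ?(ltW t0) //.
apply: le_trans (ler_normB _ _) _; apply: le_trans (lerD hB hA) _.
rewrite -mulrDr /e' mulrAC ler_pdivrMr // -[leRHS]mulrA ler_wpM2l ?(ltW e0) //.
have := ler_normD (s *: u) (t *: v); rewrite !normrZ (gtr0_norm s0) (gtr0_norm t0).
have := normr_ge0 u; have := normr_ge0 v; nra.
Unshelve. all: by end_near. Qed.

Lemma schwarz (f : V -> R) (U : set V) x u v : open U -> U x ->
  (forall y, U y -> differentiable f y) ->
  differentiable ('D_u f) x -> differentiable ('D_v f) x ->
  'D_v ('D_u f) x = 'D_u ('D_v f) x.
Proof.
move=> oU Ux df du dv; apply/eqP; rewrite -subr_eq0 -normr_eq0 eq_le normr_ge0 andbT.
apply/ler_addgt0Pr => e e0; rewrite add0r.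
have e2 : 0 < e / 2 by rewrite divr_gt0.
have H1 := @second_difference f U x u v oU Ux df du _ e2.
have H2 := @second_difference f U x v u oU Ux df dv _ e2.
have [t [[/= h1 h2] t0]] := @filter_ex _ ((0:R)^'+) _ _ (filterI (filterI H1 H2) (nbhs_right_gt 0)).
have := lerD h1 h2; rewrite -mulrDl -splitr (addrCA (t *: v)).
have tt : 0 < t ^+ 2 by rewrite exprn_gt0.
move=> h; rewrite -(ler_pM2r tt); apply: le_trans h.
rewrite -{1}(gtr0_norm tt) -normrM; apply: le_trans (ler_normB _ _).
have E (p q r s m n k : R) : p - q - r + s - k * m - (p - r - q + s - k * n) = - ((m - n) * k).
  by ring.
by rewrite E normrN.
Qed.

End Differentiability.

Section MatrixCalculus.
Context {R : realType} {V : normedModType R}.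

Lemma schwarz_mx m n (F : V -> 'M[R]_(m, n)) (U : set V) x u v : open U -> U x ->
  (forall y, U y -> differentiable F y) ->
  (forall w y, U y -> differentiable ('D_w F) y) ->
  'D_v ('D_u F) x = 'D_u ('D_v F) x.
Proof.
move=> oU Ux dF d2F; apply/matrixP => i j.
have e1 := derive_entry v i j (d2F u x Ux); have e2 := derive_entry u i j (d2F v x Ux).
apply: (etrans e1); apply: (etrans _ (esym e2)).
have E w : {near x, (fun y => 'D_w F y i j) =1 'D_w (fun y => F y i j)}.
  near=> y; apply: derive_entry; apply: dF.
  by near: y; exact: open_nbhs_nbhs.
apply: (etrans (near_eq_derive v (E u))); apply: (etrans _ (esym (near_eq_derive u (E v)))).
apply: (schwarz oU Ux).
- by move=> y Uy; apply: diff_entry; exact: dF.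
- by apply: near_eq_differentiable (E u) _; apply: diff_entry; exact: d2F.
- by apply: near_eq_differentiable (E v) _; apply: diff_entry; exact: d2F.
Unshelve. all: by end_near. Qed.

Lemma differentiable_prod (I : Type) (r : seq I) (P : pred I) (f : I -> V -> R) x :
  (forall i, differentiable (f i) x) -> differentiable (fun y => \prod_(i <- r | P i) f i y) x.
Proof.
move=> H; elim: r => [|i r IH].
  by under eq_fun do rewrite big_nil; exact: differentiable_cst.
under eq_fun do rewrite big_cons; case: (P i) => //.
exact: (@differentiableM _ _ (f i)).
Qed.

Lemma differentiable_bigsum (I : Type) (r : seq I) (P : pred I) (f : I -> V -> R) x :
  (forall i, differentiable (f i) x) -> differentiable (fun y => \sum_(i <- r | P i) f i y) x.
Proof.
move=> H; elim: r => [|i r IH].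
  by under eq_fun do rewrite big_nil; exact: differentiable_cst.
under eq_fun do rewrite big_cons; case: (P i) => //.
exact: (@differentiableD _ _ _ (f i)).
Qed.

Lemma differentiable_det n (F : V -> 'M[R]_n) x :
  (forall i j, differentiable (fun y => F y i j) x) -> differentiable (fun y => \det (F y)) x.
Proof.
move=> H; apply: differentiable_bigsum => s.
apply: (@differentiableM _ _ (cst ((-1) ^+ s)) (fun y => \prod_i F y i (s i))); first exact: differentiable_cst.
exact: differentiable_prod.
Qed.

Lemma differentiable_invmx n (F : V -> 'M[R]_n) x :
  (\near x, F x \in unitmx) -> differentiable F x -> differentiable (fun y => invmx (F y)) x.
Proof.
move=> uF dF.
have H : differentiable (fun y => (\det (F y))^-1 *: \adj (F y)) x.
  apply: differentiable_mx => i j.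
  have -> : (fun y => ((\det (F y))^-1 *: \adj (F y)) i j) =
    (fun y => (\det (F y))^-1) * (fun y => (-1) ^+ (j + i) * \det (row' j (col' i (F y)))).
    by apply/funext => y; rewrite !mxE.
  apply: differentiableM.
    apply: differentiableV; first by apply: differentiable_det => k l; exact: diff_entry.
    by have := nbhs_singleton uF; rewrite unitmxE unitfE.
  apply: (@differentiableM _ _ (cst ((-1) ^+ (j + i)))); first exact: differentiable_cst.
  apply: differentiable_det => k l.
  by under eq_fun do rewrite !mxE; exact: diff_entry.
apply: near_eq_differentiable H; near=> y; rewrite /invmx ifT //; near: y; exact: uF.
Unshelve. all: by end_near. Qed.

End MatrixCalculus.

(** * Closure properties of C^k maps *)

Section CkClosure.
Context {R : realType} {V : normedModType R}.
Variables (U : set V) (oU : open U).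

Lemma near_open (T : Type) (f k : V -> T) x : U x -> (forall y, U y -> f y = k y) ->
  \near x, f x = k x.
Proof.
move=> Ux fk; near=> y; apply: fk.
by near: y; exact: (open_nbhs_nbhs (conj oU Ux)).
Unshelve. all: by end_near. Qed.

Lemma Ck_differentiable (W : normedModType R) k (f : V -> W) : Ck k.+1 U f ->
  forall x, U x -> differentiable f x.
Proof. by case=> H _; exact: H. Qed.

Lemma Ck_derive (W : normedModType R) k (f : V -> W) v : Ck k.+1 U f -> Ck k U ('D_v f).
Proof. by case=> ? H; exact: H. Qed.

Lemma Ck_pred (W : normedModType R) k (f : V -> W) : Ck k.+1 U f -> Ck k U f.
Proof.
elim: k f => [|k IH] f [df Df] /=; first by move=> x Ux; exact/differentiable_continuous/df.
by split => // v; apply: IH; exact: Df.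
Qed.

Lemma eq_Ck (W : normedModType R) k (f h : V -> W) : (forall x, U x -> f x = h x) ->
  Ck k U f -> Ck k U h.
Proof.
elim: k f h => [|k IH] f h fh /= => [cf x Ux|[df Df]].
  have nfh := near_open Ux fh; suff : h @ x --> h x by []; rewrite -(fh x Ux).
  by apply: cvg_trans (cf x Ux); apply: near_eq_cvg.
split => [x Ux|v]; first exact: near_eq_differentiable (near_open Ux fh) (df x Ux).
apply: IH (Df v) => x Ux; apply: near_eq_derive; exact: near_open.
Qed.

Lemma Ck_cst (W : normedModType R) k (c : W) : Ck k U (fun=> c).
Proof.
elim: k c => [|k IH] c /=; first by move=> x _; exact: cst_continuous.
split => [x _|v]; first exact: differentiable_cst.
by apply: eq_Ck (IH 0) => x _; rewrite derive_cst.
Qed.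

Lemma CkD (W : normedModType R) k (f h : V -> W) : Ck k U f -> Ck k U h ->
  Ck k U (fun x => f x + h x).
Proof.
elim: k f h => [|k IH] f h /= => [cf ch x Ux|[df Df] [dh Dh]].
  by apply: (@continuousD _ _ _ f h); [exact: cf|exact: ch].
split => [x Ux|v]; first by apply: (@differentiableD _ _ _ f h); [exact: df|exact: dh].
apply: eq_Ck (IH _ _ (Df v) (Dh v)) => x Ux; apply/esym.
by apply: (@deriveD _ _ _ f h); apply: diff_derivable; [exact: df|exact: dh].
Qed.

Lemma CkM k (f h : V -> R) : Ck k U f -> Ck k U h -> Ck k U (fun x => f x * h x).
Proof.
elim: k f h => [|k IH] f h => [cf ch x Ux|Cf Ch].
  by apply: (@continuousM _ _ f h); [exact: cf|exact: ch].
have [df Df] := Cf; have [dh Dh] := Ch.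
split => [x Ux|v]; first by apply: (@differentiableM _ _ f h); [exact: df|exact: dh].
have C1 := IH _ _ (Ck_pred Cf) (Dh v); have C2 := IH _ _ (Ck_pred Ch) (Df v).
apply: eq_Ck (CkD C1 C2) => x Ux; apply/esym.
by apply: (@deriveM _ _ f h); apply: diff_derivable; [exact: df|exact: dh].
Qed.

Lemma Ck_sum k (I : Type) (r : seq I) (f : I -> V -> R) :
  (forall i, Ck k U (f i)) -> Ck k U (fun x => \sum_(i <- r) f i x).
Proof.
move=> Cf; elim: r => [|i r IH].
  by under eq_fun do rewrite big_nil; exact: Ck_cst.
by under eq_fun do rewrite big_cons; exact: CkD.
Qed.

Lemma Ck_mx m n k (F : V -> 'M[R]_(m, n)) :
  (forall i j, Ck k U (fun x => F x i j)) -> Ck k U F.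
Proof.
elim: k F => [|k IH] F /= => [cF x Ux|CF].
  apply/cvgrPdist_le => /= e e0; near=> y.
  rewrite /Num.Def.normr/= mx_normrE (bigmax_le _ (ltW e0))//= => -[i j] _.
  rewrite !mxE /=; move: i j; near: y; apply: filter_forall => i; apply: filter_forall => j.
  by have /cvgrPdist_le/(_ _ e0) := cF i j x Ux.
have dF x : U x -> differentiable F x.
  by move=> Ux; apply: differentiable_mx => i j; case: (CF i j) => + _; exact.
split => // v; apply: IH => i j; case: (CF i j) => _ /(_ v).
by apply: eq_Ck => x Ux; apply/esym; apply: derive_entry; exact: dF.
Unshelve. all: by end_near. Qed.

Lemma Ck_entry m n k (F : V -> 'M[R]_(m, n)) i j : Ck k U F -> Ck k U (fun x => F x i j).
Proof.
elim: k F => [|k IH] F /= => [cF x Ux|[dF DF]].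
  exact: (continuous_comp (cF x Ux) (@coord_continuous _ _ _ i j _)).
split => [x Ux|v]; first by apply: diff_entry; exact: dF.
by apply: eq_Ck (IH _ (DF v)) => x Ux; apply: derive_entry; exact: dF.
Qed.

Lemma Ck_mulmx m n p k (F : V -> 'M[R]_(m, n)) (G : V -> 'M[R]_(n, p)) :
  Ck k U F -> Ck k U G -> Ck k U (fun x => F x *m G x).
Proof.
move=> CF CG; apply: Ck_mx => i j; under eq_fun do rewrite mxE.
by apply: Ck_sum => l; apply: CkM; exact: Ck_entry.
Qed.

Lemma CkZ m n k (f : V -> R) (F : V -> 'M[R]_(m, n)) :
  Ck k U f -> Ck k U F -> Ck k U (fun x => f x *: F x).
Proof.
move=> Cf CF; apply: Ck_mx => i j; under eq_fun do rewrite mxE.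
by apply: CkM => //; exact: Ck_entry.
Qed.

Lemma Ck_id k : Ck k U id.
Proof.
case: k => [x _|k]; first exact: cvg_id.
split => [x _|v]; first exact: ex_diff.
by apply: eq_Ck (Ck_cst k v) => x _; rewrite derive_id.
Qed.

End CkClosure.

Section CkLocal.
Context {R : realType} {V : normedModType R}.

Lemma Ck_local (W : normedModType R) k (U : set V) (f : V -> W) :
  (forall x, U x -> exists2 U', U' x & Ck k U' f) -> Ck k U f.
Proof.
elim: k f => [|k IH] f H /= => [x /H[U' U'x]|]; first exact.
split => [x /H[U' U'x []]|v]; first by move=> + _; exact.
apply: IH => x /H[U' U'x [_ Df]]; exists U' => //; exact: Df.
Qed.

End CkLocal.

Section CkComposition.
Context {R : realType} {V : normedModType R} {m : nat}.

(** [Ck] differentiates along constant directions only, whereas the chain rule produces the moving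
    direction ['D_v h x]; expanding it in coordinates gives sums of products to which the induction
    applies. *)
Lemma Ck_comp k (U : set V) (U' : set 'rV[R]_m) (f : 'rV[R]_m -> R) (h : V -> 'rV[R]_m) :
  open U -> (forall x, U x -> U' (h x)) -> Ck k U' f -> Ck k U h -> Ck k U (f \o h).
Proof.
move=> oU UU'; elim: k f => [|k IH] f => [cf ch x Ux|Cf Ch].
  by apply: continuous_comp; [exact: ch|exact/cf/UU'].
have [df Df] := Cf; have [dh Dh] := Ch.
split => [x Ux|v]; first by apply: differentiable_comp; [exact: dh|exact/df/UU'].
have C1 : Ck k U (fun x => \sum_a 'D_v h x 0 a * ('D_(delta_mx 0 a) f \o h) x).
  apply: Ck_sum => // a; apply: CkM => //.
    by apply: Ck_entry => //; exact: Dh.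
  by apply: IH; [exact: Df|exact: Ck_pred].
apply: eq_Ck C1 => // x Ux; have d1 := dh x Ux; have d2 := df _ (UU' _ Ux).
have e : 'D_v (f \o h) x = 'D_('D_v h x) f (h x).
  apply: (etrans (deriveE v (differentiable_comp d1 d2))).
  apply: (etrans _ (esym (deriveE _ d2))).
  by rewrite diff_comp //= (deriveE v d1).
by apply: (etrans _ (esym e)); apply: (etrans _ (esym (derive_dir _ d2))).
Qed.

End CkComposition.

(** * A smooth function flat at the origin, and bump functions *)

Section Flat.
Context {R : realType}.

(** The exponent [m] is there because the derivative of [flat m] is a combination of [flat m.+2] and
    [flat m.+1]: smoothness is then one induction carried out for all [m] together. *)
Definition flat (m : nat) (t : R) : R := if 0 < t then t^-1 ^+ m * expR (- t^-1) else 0.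

Lemma flat_gt0 m t : 0 < t -> 0 < flat m t.
Proof. by move=> t0; rewrite /flat t0 mulr_gt0 ?expR_gt0 // exprn_gt0 // invr_gt0. Qed.

Lemma flat_le0 m t : t <= 0 -> flat m t = 0.
Proof. by move=> t0; rewrite /flat ltNge t0. Qed.

(** From exp(u) >= u^(m+2) / (m+2)! at u = 1/t. Two powers more than [m] leave the factor t^2, which
    makes the difference quotient at 0 tend to 0. *)
Lemma flat_bound m t : `|flat m t| <= (m.+2)`!%:R * t ^+ 2.
Proof.
rewrite /flat; case: ifPn => [t0|]; last by rewrite normr0 mulr_ge0 // exprn_even_ge0.
have u0 : 0 < t^-1 by rewrite invr_gt0.
rewrite ger0_norm; last by rewrite mulr_ge0 ?expR_ge0 // exprn_ge0 // ltW.
rewrite expRN ler_pdivrMr ?expR_gt0 //.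
have := expR_ge1Dxn m.+1 (ltW u0); set e := expR _ => h.
have f0 : 0 < (m.+2)`!%:R :> R by rewrite ltr0n fact_gt0.
have : t^-1 ^+ m.+2 <= (m.+2)`!%:R * e.
  by rewrite -ler_pdivrMl // [leLHS]mulrC; apply: le_trans h; rewrite lerDr.
have -> : t^-1 ^+ m = t ^+ 2 * t^-1 ^+ m.+2.
  by rewrite -[m.+2]addn2 exprD mulrCA -exprMn divff ?gt_eqF // expr1n mulr1.
by move=> h'; rewrite -[leRHS]mulrA [leRHS]mulrCA ler_wpM2l // exprn_ge0 // ltW.
Qed.

Lemma is_derive_flat m (t : R) : is_derive t 1 (flat m) (flat m.+2 t - m%:R * flat m.+1 t).
Proof.
have [t0|t0|->] := ltgtP t 0.
- rewrite !flat_le0 ?(ltW t0) // mulr0 subr0.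
  apply: (@near_eq_is_derive _ _ _ (fun=> 0)).
  near=> y; rewrite flat_le0 //; apply: ltW; near: y; exact: lt_nbhsl.
- apply: (@near_eq_is_derive _ _ _ (fun y : R => y^-1 ^+ m * expR (- y^-1) : R)); last first.
  rewrite /flat t0.
  have tn0 : t != 0 by rewrite gt_eqF.
  have di : is_derive t 1 (fun y : R => y^-1) (- t^-1 ^+ 2).
    by apply: is_derive_eq (is_deriveV tn0 (is_derive_id t 1)) _; rewrite /GRing.scale /= mulr1 exprVn.
  have de := @is_derive1_comp _ expR (fun y => - y^-1) t _ _ (is_derive_expR _) (is_deriveN di).
  have dM := @is_deriveM _ _ _ _ _ _ _ _ (is_deriveX m di) de.
  have E : (fun y : R => y^-1 ^+ m * expR (- y^-1)) =
      (fun y : R => y^-1) ^+ m * (expR \o (fun y : R => - y^-1)).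
    apply/funext => y; rewrite [RHS]/(_ * _) /=; congr (_ * _).
    by elim: m {dM} => [|n IH]; rewrite ?expr0 // !exprS IH.
  rewrite E; apply: is_derive_eq dM _; rewrite -[LHS]/(_ + _).
  have -> : ((fun y : R => y^-1) ^+ m) t = t^-1 ^+ m.
    by elim: m {E} => [|n IH]; rewrite ?expr0 // !exprS -IH.
  rewrite /GRing.scale /=.
  by case: m {E} => [|m] /=; rewrite ?exprS; ring.
  by near=> y; rewrite /flat ifT //; near: y; exact: lt_nbhsr.
- rewrite !flat_le0 ?mulr0 ?subr0 //.
  have H : h^-1 *: (flat m (h *: 1 + 0) - flat m 0) @[h --> (0:R)^'] --> (0 : R).
    apply/cvgrPdist_le => e e0; near=> h.
    have h0 : h != 0 by near: h; exact: nbhs_dnbhs_neq.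
    rewrite (flat_le0 m (lexx 0)) subr0 addr0 sub0r normrN /GRing.scale /= mulr1 normrM.
    apply: (@le_trans _ _ (`|h^-1| * ((m.+2)`!%:R * h ^+ 2))).
      by rewrite ler_wpM2l // flat_bound.
    rewrite -[h ^+ 2]real_normK ?num_real // expr2 normfV mulrCA mulKf ?normr_eq0 //.
    rewrite mulrC -ler_pdivlMr ?ltr0n ?fact_gt0 //; near: h; apply: dnbhs0_le.
    by rewrite divr_gt0 // ltr0n fact_gt0.
  apply: DeriveDef; first by apply/cvg_ex; exists 0.
  exact: cvg_lim H.
Unshelve. all: by end_near. Qed.

Lemma Ck_flat (V : normedModType R) k m (U : set V) (f : V -> R) : open U ->
  (forall k, Ck k U f) -> Ck k U (fun x => flat m (f x)).
Proof.
move=> oU Cf; have df x : U x -> differentiable f x by apply: (@Ck_differentiable _ _ _ _ 0).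
have dc n x : U x -> differentiable (fun x => flat n (f x)) x.
  move=> Ux; apply: (@differentiable_comp _ _ _ _ f (flat n)); first exact: df.
  by apply/derivable1_diffP; have [] := is_derive_flat n (f x).
elim: k m => [|k IH] m; first by move=> x Ux; exact/differentiable_continuous/dc.
split => [x|v]; first exact: dc.
have C1 : Ck k U (fun x => 'D_v f x * (flat m.+2 (f x) + (- m%:R) * flat m.+1 (f x))).
  apply: CkM => //; first exact: (Ck_derive v (Cf k.+1)).
  by apply: CkD => //; apply: CkM => //; exact: Ck_cst.
apply: eq_Ck C1 => // x Ux; apply/esym.
apply: (etrans (deriveE v (dc m x Ux))).
have dfl : differentiable (flat m) (f x).
  by apply/derivable1_diffP; have [] := is_derive_flat m (f x).
rewrite (diff_comp (df x Ux) dfl) /= -(deriveE v (df x Ux)).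
have [_ val] := is_derive_flat m (f x).
move: ('D_v f x : R) => w.
have -> : 'd (flat m) (f x) w = w * 'd (flat m) (f x) (1 : R).
  by rewrite -[X in X * _]mulr1 -mulrA mul1r -{1}[w]mulr1; exact: linearZ.
rewrite -(@deriveE _ _ _ _ _ (1 : R) dfl) val; ring.
Qed.
End Flat.

(** * Vector fields with a prescribed value *)

Section Jacobian.
Context {R : realType} {m n : nat}.

Lemma jacobian_entry (f : 'rV[R]_m -> 'rV[R]_n) x a b : differentiable f x ->
  'J f x a b = 'D_(delta_mx 0 a) f x 0 b.
Proof. by move=> df; have -> := deriveEjacobian (delta_mx 0 a) df; rewrite -rowE [RHS]mxE. Qed.

Lemma Ck_jacobian k (U : set 'rV[R]_m) (f : 'rV[R]_m -> 'rV[R]_n) : open U ->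
  Ck k.+1 U f -> Ck k U (fun x => 'J f x).
Proof.
move=> oU [df Df]; apply: Ck_mx => // a b.
apply: eq_Ck (Ck_entry oU 0 b (Df (delta_mx 0 a))) => // x Ux.
by apply/esym; apply: jacobian_entry; exact: df.
Qed.

Lemma jacobian_comp p (f : 'rV[R]_m -> 'rV[R]_n) (h : 'rV[R]_p -> 'rV[R]_m) x :
  differentiable h x -> differentiable f (h x) ->
  'J (f \o h) x = 'J h x *m 'J f (h x).
Proof.
move=> dh df; apply/row_matrixP => a; rewrite row_mul !rowE.
rewrite -(deriveEjacobian _ (differentiable_comp dh df)) -(deriveEjacobian _ dh) -(deriveEjacobian _ df).
rewrite (deriveE _ (differentiable_comp dh df)) (deriveE _ dh) (deriveE _ df).
by rewrite diff_comp.
Qed.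

Lemma near_eq_jacobian (f h : 'rV[R]_m -> 'rV[R]_n) x : differentiable f x ->
  (\near x, f x = h x) -> 'J f x = 'J h x.
Proof.
move=> df fh; have dh := near_eq_differentiable fh df.
apply/row_matrixP => a; apply: (etrans (rowE _ _)); apply: (etrans _ (esym (rowE _ _))).
apply: (etrans (esym (deriveEjacobian _ df))); apply: (etrans _ (deriveEjacobian _ dh)).
exact: near_eq_derive.
Qed.

Lemma jacobian_id (x : 'rV[R]_m) : 'J id x = 1%:M.
Proof.
by apply/row_matrixP => a; rewrite !rowE -deriveEjacobian // derive_id mulmx1.
Qed.

End Jacobian.

Section Bump.
Context {R : realType} {d : nat}.

(** A sum of squares is polynomial in the coordinates, unlike the ambient norm, which is a maximum;
    the Euclidean ball lies inside the ball of that norm, whence [bump_support]. *)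
Definition bump (x0 : 'rV[R]_d) (r : R) (x : 'rV[R]_d) : R :=
  flat 0 (r ^+ 2 - \sum_a (x 0 a - x0 0 a) ^+ 2).

Lemma bump_center x0 r : 0 < r -> 0 < bump x0 r x0.
Proof.
move=> r0; apply: flat_gt0; rewrite big1 ?subr0 ?exprn_gt0 // => a _.
by rewrite subrr expr0n.
Qed.

Lemma bump_support x0 r x : 0 < r -> bump x0 r x != 0 -> ball x0 r x.
Proof.
move=> r0 /eqP h; rewrite -ball_normE /ball_ /= distrC.
have : 0 < r ^+ 2 - \sum_a (x 0 a - x0 0 a) ^+ 2.
  by rewrite ltNge; apply/negP => /(flat_le0 0) e; exact: h.
rewrite subr_gt0 => {}h; rewrite /Num.Def.normr/= mx_normrE; apply: bigmax_lt => // -[i a] _.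
rewrite !mxE (ord1 i) -(ltr_pXn2r (n := 2)) ?nnegrE ?(ltW r0) // real_normK ?num_real //.
by apply: le_lt_trans h; rewrite (bigD1 a) //= lerDl sumr_ge0 // => b _; exact: sqr_ge0.
Qed.

Lemma Ck_bump k (U : set 'rV[R]_d) x0 r : open U -> Ck k U (bump x0 r).
Proof.
move=> oU; apply: Ck_flat => // {}k.
have c := fun a => Ck_entry oU 0 a (Ck_id oU k).
have s : Ck k U (fun x => \sum_a (x 0 a - x0 0 a) ^+ 2).
  apply: Ck_sum => // a; have e : Ck k U (fun x => x 0 a - x0 0 a) by apply: CkD => //; exact: Ck_cst.
  exact: CkM.
have := CkD oU (Ck_cst oU k (r ^+ 2 : R)) (CkM oU (Ck_cst oU k (-1 : R)) s).
by apply: eq_Ck => // x _; rewrite mulN1r.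
Qed.

End Bump.

Section GlobalField.
Context {R : realType} {d : nat} {M : topologicalType}.
Variable A : smooth_manifold R d M.
Local Notation tr i j := (transition (A i) (A j)).
Local Notation ov i j := (overlap (A i) (A j)).

Lemma overlap_open i j : open (ov i j).
Proof.
rewrite openE => x [hx hd]; rewrite /interior.
have n1 : \near x, cimg (A i) x by exact: (open_nbhs_nbhs (conj (cimg_open (A i)) hx)).
have n2 : \near x, cdom (A j) (cinv (A i) x).
  by apply: (cinv_cont hx); exact: (open_nbhs_nbhs (conj (cdom_open (A j)) hd)).
by near=> y; split; near: y.
Unshelve. all: by end_near. Qed.

Lemma transition_overlap i j x : ov i j x -> ov j i (tr i j x).
Proof.
move=> [hx hd]; split; first exact: cfun_img.
by rewrite /transition cfunK //; exact: cinv_dom.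
Qed.

Lemma cinv_transition i j x : ov i j x -> cinv (A j) (tr i j x) = cinv (A i) x.
Proof. by move=> [hx hd]; rewrite /transition cfunK. Qed.

Lemma transition_trans i j k x : ov i j x -> tr j k (tr i j x) = tr i k x.
Proof. by move=> h; rewrite /transition -/(tr i j x) cinv_transition. Qed.

Lemma transition_self i x : cimg (A i) x -> tr i i x = x.
Proof. by move=> h; rewrite /transition cinvK. Qed.

Lemma transition_diff i j x : ov i j x -> differentiable (tr i j) x.
Proof. by move=> h; have [H _] := transition_smooth i j 1%N; exact: H. Qed.

Lemma jacobian_transition i j k x : ov i j x -> ov i k x ->
  'J (tr i k) x = 'J (tr i j) x *m 'J (tr j k) (tr i j x).
Proof.
move=> hj hk.
have hjk : ov j k (tr i j x).
  split; first by case: (transition_overlap hj).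
  by rewrite cinv_transition //; case: hk.
rewrite -jacobian_comp; [|exact: transition_diff|exact: transition_diff].
apply: near_eq_jacobian; first exact: transition_diff.
near=> y; apply/esym; apply: (@transition_trans i j k y); near: y.
by apply: open_nbhs_nbhs; split; [exact: overlap_open|].
Unshelve. all: by end_near. Qed.

Lemma jacobian_transition_self i x : cimg (A i) x -> 'J (tr i i) x = 1%:M.
Proof.
move=> hx; rewrite -(jacobian_id x); apply: near_eq_jacobian.
  by apply: transition_diff; split => //; exact: cinv_dom.
near=> y; apply: (@transition_self i y); near: y.
exact: (open_nbhs_nbhs (conj (cimg_open (A i)) hx)).
Unshelve. all: by end_near. Qed.

Variables (i0 : chart_index A) (x0 : 'rV[R]_d) (hx0 : cimg (A i0) x0) (u : 'rV[R]_d).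

Let radius : exists2 r : R, 0 < r & closed_ball x0 r `<=` cimg (A i0).
Proof.
have /nbhs_closedballP[r rs] : nbhs x0 (cimg (A i0)).
  exact: (open_nbhs_nbhs (conj (cimg_open (A i0)) hx0)).
by exists r%:num.
Qed.

Let r := sval (cid2 radius).
Let r0 : 0 < r. Proof. by rewrite /r; case: cid2. Qed.
Let rs : closed_ball x0 r `<=` cimg (A i0). Proof. by rewrite /r; case: cid2. Qed.

(** Compact, hence closed because the manifold is Hausdorff. This makes the extension by zero smooth
    at points outside the domain of the chart [i0]. *)
Let K := cinv (A i0) @` closed_ball x0 r.

Let K_closed : closed K.
Proof.
apply: compact_closed; first exact: (manifold_hausdorff A).
apply: continuous_compact.
  apply: continuous_in_subspaceT => y; rewrite inE => /rs; exact: cinv_cont.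
apply: bounded_closed_compact; last exact: closed_ball_closed.
exists (`|x0| + r); split; first exact: num_real.
move=> t ht y; rewrite closed_ballE // /closed_ball_ /= => hy; apply: le_trans (ltW ht).
rewrite -[y](subKr x0); apply: le_trans (ler_normB _ _) _; by rewrite lerD2l.
Qed.

Definition local_field : chart_index A -> 'rV[R]_d -> 'rV[R]_d := fun j y =>
  if `[< ov j i0 y >] then bump x0 r (tr j i0 y) *: (u *m 'J (tr i0 j) (tr j i0 y)) else 0.

Lemma local_fieldE j y : ov j i0 y ->
  local_field j y = bump x0 r (tr j i0 y) *: (u *m 'J (tr i0 j) (tr j i0 y)).
Proof. by move=> h; rewrite /local_field ifT //; exact/asboolP. Qed.

Lemma local_field0 j y : ~ ov j i0 y -> local_field j y = 0.
Proof. by move=> h; rewrite /local_field ifF //; apply/asboolP. Qed.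

Lemma local_field_smooth j : smooth (cimg (A j)) (local_field j).
Proof.
move=> k; apply: Ck_local => y hy.
have [hov|hov] := pselect (ov j i0 y).
  exists (ov j i0) => //.
  have oU := @overlap_open j i0; have oU' := @overlap_open i0 j.
  have Ct k' : Ck k' (ov j i0) (tr j i0) by exact: transition_smooth.
  have tO z : ov j i0 z -> ov i0 j (tr j i0 z) by exact: transition_overlap.
  have C1 : Ck k (ov j i0) (fun z => bump x0 r (tr j i0 z)).
    exact: (Ck_comp oU tO (Ck_bump k x0 r oU') (Ct k)).
  have C2 : Ck k (ov j i0) (fun z => 'J (tr i0 j) (tr j i0 z)).
    apply: Ck_mx => // a b.
    have CJ := Ck_entry oU' a b (Ck_jacobian oU' (transition_smooth i0 j k.+1)).
    exact: (Ck_comp oU tO CJ (Ct k)).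
  have C3 := CkZ oU C1 (Ck_mulmx oU (Ck_cst oU k u) C2).
  by apply: eq_Ck C3 => // z hz; rewrite local_fieldE.
(* Near a point off the overlap the field is identically zero: on [W] either the overlap is missed
   or the bump vanishes, since its support lies over [K]. *)
pose W := [set z | cimg (A j) z /\ ~ K (cinv (A j) z)].
have oW : open W.
  rewrite openE => z [hz hK]; rewrite /interior.
  have n1 : \near z, cimg (A j) z.
    by apply: open_nbhs_nbhs; split; [exact: (cimg_open (A j))|].
  have n2 : \near z, (~` K) (cinv (A j) z).
    by apply: (cinv_cont hz); apply: open_nbhs_nbhs; split => //; exact: closed_openC.
  by near=> w; split; near: w.
exists W.
  split => // -[z hz e]; apply: hov; split => //; rewrite -e.
  by apply: cinv_dom; exact: rs.
apply: eq_Ck (Ck_cst oW k 0) => // z [hz hK].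
have [h|h] := pselect (ov j i0 z); last by rewrite local_field0.
rewrite local_fieldE //; have [->|b0] := eqVneq (bump x0 r (tr j i0 z)) 0.
  by rewrite scale0r.
exfalso; apply: hK; exists (tr j i0 z); last exact: cinv_transition.
by apply: subset_closed_ball; exact: bump_support.
Unshelve. all: by end_near. Qed.

Lemma local_field_change i j x : ov i j x ->
  local_field j (tr i j x) = local_field i x *m 'J (tr i j) x.
Proof.
move=> hij; have e := cinv_transition hij.
have hji := transition_overlap hij.
have [h|h] := pselect (ov i i0 x); last first.
  rewrite !local_field0 ?mul0mx // => -[h1 h2]; apply: h; split; first by case: hij.
  by rewrite -e.
have h' : ov j i0 (tr i j x) by split; [case: hji|rewrite e; case: h].
rewrite !local_fieldE // transition_trans // -scalemxAl -mulmxA; congr (_ *: (_ *m _)).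
have h0 := transition_overlap h.
have e2 : tr i0 i (tr i i0 x) = x.
  by rewrite transition_trans // transition_self //; case: hij.
rewrite -{3}e2; apply: jacobian_transition => //.
by split; [case: h0|rewrite cinv_transition //; case: hij].
Qed.

(** The bump is not normalised, so the value at the point is only a positive multiple of [u]; this
    suffices for identities homogeneous in the field. *)
Lemma exists_vector_field : exists X : vector_field A, exists2 b : R, 0 < b & X i0 x0 = b *: u.
Proof.
exists (VectorField local_field_smooth local_field_change); exists (bump x0 r x0).
  exact: bump_center.
have h : ov i0 i0 x0 by split => //; exact: cinv_dom.
by rewrite /= local_fieldE // transition_self // jacobian_transition_self // mulmx1.
Qed.

End GlobalField.

(** * Covariant calculus in a chart *)

Section BilinearForm.
Context {R : realType} {d : nat}.
Implicit Types (G : 'M[R]_d) (u v w : 'rV[R]_d).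

Lemma bilDl G u v w : bil G (u + v) w = bil G u w + bil G v w.
Proof. by rewrite /bil !mulmxDl mxE. Qed.

Lemma bilZl G a u w : bil G (a *: u) w = a * bil G u w.
Proof. by rewrite /bil -!scalemxAl mxE. Qed.

Lemma bilDr G u v w : bil G w (u + v) = bil G w u + bil G w v.
Proof. by rewrite /bil linearD mulmxDr mxE. Qed.

Lemma bilZr G a u w : bil G w (a *: u) = a * bil G w u.
Proof. by rewrite /bil linearZ -scalemxAr mxE. Qed.

Lemma bil_delta G a b : bil G (delta_mx 0 a) (delta_mx 0 b) = G a b.
Proof. by rewrite /bil -!rowE !trmx_delta -!colE !mxE. Qed.

Lemma bil_scale G u v w : bil G u v *: w = u *m (G *m v^T *m w).
Proof. by rewrite /bil !mulmxA [in RHS](mx11_scalar (u *m G *m v^T)) mul_scalar_mx. Qed.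

Lemma appE w u v : app w u *: v = u *m w^T *m v.
Proof. by rewrite /app [in RHS](mx11_scalar (u *m w^T)) mul_scalar_mx. Qed.

End BilinearForm.

Lemma addmxE (R : nmodType) m n (A B : 'M[R]_(m, n)) i j : (A + B) i j = A i j + B i j.
Proof. by rewrite mxE. Qed.

Lemma oppmxE (R : zmodType) m n (A : 'M[R]_(m, n)) i j : (- A) i j = - A i j.
Proof. by rewrite mxE. Qed.

Lemma zeromxE (R : nmodType) m n i j : (0 : 'M[R]_(m, n)) i j = 0.
Proof. by rewrite mxE. Qed.

Lemma scalemxE (R : pzRingType) m n a (A : 'M[R]_(m, n)) i j : (a *: A) i j = a * A i j.
Proof. by rewrite mxE. Qed.

Ltac mx_linear :=
  rewrite ?(mulmxDl, mulmxDr, mulmxN, mulNmx, mulmxA);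
  let i := fresh in let j := fresh in
  apply/matrixP => i j; rewrite ?(addmxE, oppmxE); ring.

Lemma derive_fun_add (R : realType) (V W : normedModType R) (f k : V -> W) x u :
  differentiable f x -> differentiable k x ->
  'D_u (fun y => f y + k y) x = 'D_u f x + 'D_u k x.
Proof. by move=> df dk; apply: (@deriveD _ _ _ f k); exact: diff_derivable. Qed.

Lemma derive_fun_sub (R : realType) (V W : normedModType R) (f k : V -> W) x u :
  differentiable f x -> differentiable k x ->
  'D_u (fun y => f y - k y) x = 'D_u f x - 'D_u k x.
Proof. by move=> df dk; apply: (@deriveB _ _ _ f k); exact: diff_derivable. Qed.

Section CovariantCalculus.
Context {R : realType} {V : normedModType R}.

(* [l] and [r] encode the types of the row and column indices of [F]: a contravariant column
   index contributes [r = c], a covariant row index [l = - c], a dual one the transposes and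
   a missing one [0], where [c] is the connection matrix in the direction [u]. *)
Definition cov_deriv m n (l : 'M[R]_m) (r : 'M[R]_n) (F : V -> 'M[R]_(m, n)) x u F' :=
  differentiable F x /\ 'D_u F x + l *m F x + F x *m r = F'.

Variables (x u : V).

Lemma cov_deriv_uniq m n l r (F : V -> 'M[R]_(m, n)) F1 F2 :
  cov_deriv l r F x u F1 -> cov_deriv l r F x u F2 -> F1 = F2.
Proof. by case=> _ <- [_ <-]. Qed.

Lemma cov_deriv_near m n l r (F K : V -> 'M[R]_(m, n)) F' :
  (\near x, F x = K x) -> cov_deriv l r F x u F' -> cov_deriv l r K x u F'.
Proof.
move=> FK [dF <-]; split; first exact: near_eq_differentiable dF.
by rewrite (near_eq_derive u FK) (nbhs_singleton FK).
Qed.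

Lemma cov_deriv0 m n l r : cov_deriv l r (fun=> 0 : 'M[R]_(m, n)) x u 0.
Proof.
by split; [exact: differentiable_cst|rewrite mulmx0 mul0mx !addr0; exact: derive_cst].
Qed.

Lemma cov_deriv_cst m n l r (A : 'M[R]_(m, n)) :
  cov_deriv l r (fun=> A) x u (l *m A + A *m r).
Proof.
by split; [exact: differentiable_cst|rewrite (derive_cst A) add0r].
Qed.

Lemma cov_derivD m n l r (F K : V -> 'M[R]_(m, n)) F' K' :
  cov_deriv l r F x u F' -> cov_deriv l r K x u K' ->
  cov_deriv l r (fun y => F y + K y) x u (F' + K').
Proof.
move=> [dF <-] [dK <-]; split; first exact: (@differentiableD _ _ _ F K).
rewrite derive_fun_add //.
by move: ('D_u F x) ('D_u K x) => a b; mx_linear.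
Qed.

Lemma cov_derivN m n l r (F : V -> 'M[R]_(m, n)) F' :
  cov_deriv l r F x u F' -> cov_deriv l r (fun y => - F y) x u (- F').
Proof.
move=> [dF <-]; split; first exact: (@differentiableN _ _ _ F).
have -> : 'D_u (fun y => - F y) x = - 'D_u F x.
  by apply: (@deriveN _ _ _ F); exact: diff_derivable.
by move: ('D_u F x) => a; mx_linear.
Qed.

(** The connection matrices on the contracted index, [k] on the left factor and [- k] on the right
    one, cancel. *)
Lemma cov_derivM m n p l k r (F : V -> 'M[R]_(m, n)) (K : V -> 'M[R]_(n, p)) F' K' :
  cov_deriv l k F x u F' -> cov_deriv (- k) r K x u K' ->
  cov_deriv l r (fun y => F y *m K y) x u (F' *m K x + F x *m K').
Proof.
move=> [dF <-] [dK <-]; split; first exact: differentiable_mulmx.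
rewrite derive_mulmx //; move: ('D_u F x) ('D_u K x) => a b; mx_linear.
Qed.

Lemma cov_derivT m n l r (F : V -> 'M[R]_(m, n)) F' :
  cov_deriv l r F x u F' -> cov_deriv r^T l^T (fun y => (F y)^T) x u F'^T.
Proof.
move=> [dF <-]; split; first exact: differentiable_trmx.
rewrite derive_trmx //; move: ('D_u F x) => a.
by rewrite !linearD /= !trmx_mul addrAC.
Qed.

End CovariantCalculus.

Section ChartGeometry.
Context {R : realType} {d : nat}.
Notation V := 'rV[R]_d.
Variables (U : set V) (oU : open U) (F G : V -> 'M[R]_d) (xi : V -> V).
Variable C : V -> 'I_d -> 'M[R]_d.

(** Tangent vectors being rows, [w *m connection v x] is the derivative of the constant field [w]
    along [v]. *)
Definition connection (v x : V) : 'M[R]_d := \sum_a v 0 a *: C x a.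
Local Notation Cv := connection.
(* [locked]: otherwise unification unfolds these fields and rewrites inside their defining sums. *)
Definition nabla_endo (v x : V) : 'M[R]_d :=
  locked ('D_v F x + F x *m Cv v x - Cv v x *m F x).
Definition nabla_vec (v x : V) : V := locked ('D_v xi x + xi x *m Cv v x).

Lemma nabla_endoE v : nabla_endo v = fun x => 'D_v F x + F x *m Cv v x - Cv v x *m F x.
Proof. by apply/funext => x; rewrite /nabla_endo -lock. Qed.

Lemma nabla_vecE v : nabla_vec v = fun x => 'D_v xi x + xi x *m Cv v x.
Proof. by apply/funext => x; rewrite /nabla_vec -lock. Qed.

Local Notation P := nabla_endo.
Local Notation hv := nabla_vec.

Hypothesis dF : forall x, U x -> differentiable F x.
Hypothesis d2F : forall v x, U x -> differentiable ('D_v F) x.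
Hypothesis dG : forall x, U x -> differentiable G x.
Hypothesis d2G : forall v x, U x -> differentiable ('D_v G) x.
Hypothesis dxi : forall x, U x -> differentiable xi x.
Hypothesis d2xi : forall v x, U x -> differentiable ('D_v xi) x.
Hypothesis dC : forall a x, U x -> differentiable (C^~ a) x.
Hypothesis Csym : forall x u v, U x -> u *m Cv v x = v *m Cv u x.
Hypothesis metric : forall x v, U x -> 'D_v G x = Cv v x *m G x + G x *m (Cv v x)^T.
Hypothesis Gsym : forall x, U x -> (G x)^T = G x.
Hypothesis F2 : forall x, U x -> F x *m F x = - 1%:M + G x *m (xi x)^T *m xi x.
Hypothesis FG : forall x, U x -> F x *m G x = - (G x *m (F x)^T).
Hypothesis nc : forall x u, U x -> u *m P u x = 0.

Lemma Cv_linear x : linear (Cv^~ x).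
Proof.
move=> a u v; rewrite /connection scaler_sumr -big_split; apply: eq_bigr => k _ /=.
by rewrite !mxE scalerDl scalerA.
Qed.

Lemma differentiable_Cv v x : U x -> differentiable (Cv v) x.
Proof.
move=> Ux; have -> : Cv v = \sum_a (v 0 a *: C^~ a).
  by apply/funext => y; rewrite fct_sumE.
by apply: differentiable_sum => a; apply: differentiableZ; exact: dC.
Qed.

Lemma nabla_endo_linear x : U x -> linear (P^~ x).
Proof.
move=> Ux a u v; have h := derive_dir_linear (dF Ux) a u v.
rewrite !nabla_endoE h Cv_linear; move: ('D_u F x) ('D_v F x) => p q.
rewrite mulmxDl mulmxDr -!scalemxAl -!scalemxAr !scalerDr scalerN opprD.
by rewrite !addrA; apply/matrixP => i j; rewrite ?(addmxE, oppmxE); ring.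
Qed.

Lemma nabla_vec_linear x : U x -> linear (hv^~ x).
Proof.
move=> Ux a u v; have h := derive_dir_linear (dxi Ux) a u v.
rewrite !nabla_vecE h Cv_linear; move: ('D_u xi x) ('D_v xi x) => p q.
rewrite mulmxDr -!scalemxAr !scalerDr.
by rewrite !addrA; apply/matrixP => i j; rewrite ?(addmxE, oppmxE); ring.
Qed.

Lemma nc_skew x u v : U x -> u *m P v x = - (v *m P u x).
Proof.
move=> Ux; have := nc (u + v) Ux.
have -> : P (u + v) x = P u x + P v x.
  by have := nabla_endo_linear Ux 1 u v; rewrite !scale1r.
rewrite mulmxDl !(mulmxDr _ (P u x)) (nc u Ux) (nc v Ux) add0r addr0 => /eqP.
by rewrite addr_eq0 => /eqP.
Qed.

Lemma cov_F x v : U x -> cov_deriv (- Cv v x) (Cv v x) F x v (P v x).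
Proof. by move=> Ux; split; [exact: dF|rewrite nabla_endoE mulNmx addrAC]. Qed.

Lemma cov_xi x v : U x -> cov_deriv (0 : 'M[R]_1) (Cv v x) xi x v (hv v x).
Proof. by move=> Ux; split; [exact: dxi|rewrite nabla_vecE mul0mx addr0]. Qed.

Lemma cov_G x v : U x -> cov_deriv (- Cv v x) (- (Cv v x)^T) G x v 0.
Proof.
move=> Ux; split; first exact: dG.
by rewrite metric // mulNmx mulmxN addrAC addrK subrr.
Qed.

(** Pattern for the differentiated identities: both sides get a covariant derivative from the
    Leibniz rules, and [cov_deriv_uniq] equates them. Here [FG] is differentiated. *)
Lemma nabla_endo_skew x v : U x -> P v x *m G x + G x *m (P v x)^T = 0.
Proof.
move=> Ux; have cF := cov_F v Ux; have cG := cov_G v Ux.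
have c1 := cov_derivM cF cG.
(* The double negation gives the row type the shape [- k] that [cov_derivM] expects from its second
   factor. *)
have cFT := cov_derivT cF; rewrite linearN /= -[in X in cov_deriv X](opprK (Cv v x)^T) in cFT.
have c2 := cov_derivM cG cFT.
have c3 := cov_derivD c1 c2.
have := cov_deriv_uniq (cov_deriv_near (near_open oU Ux _) c3) (cov_deriv0 _ _ _ _).
rewrite mulmx0 addr0 mul0mx add0r; apply => y Uy.
by rewrite FG // addNr.
Qed.

Lemma eq_cov_deriv m n l r (A B : V -> 'M[R]_(m, n)) x u A' B' : U x ->
  (forall y, U y -> A y = B y) -> cov_deriv l r A x u A' -> cov_deriv l r B x u B' -> A' = B'.
Proof.
by move=> Ux AB cA; apply: cov_deriv_uniq; exact: (cov_deriv_near (near_open oU Ux AB) cA).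
Qed.

Lemma cov_GxiT x v : U x ->
  cov_deriv (- Cv v x) (0 : 'M[R]_1) (fun y => G y *m (xi y)^T) x v (G x *m (hv v x)^T).
Proof.
move=> Ux; have cT := cov_derivT (cov_xi v Ux).
rewrite -(opprK (Cv v x)^T) trmx0 in cT.
by have := cov_derivM (cov_G v Ux) cT; rewrite mul0mx add0r.
Qed.

Lemma nabla_endo_F x v : U x ->
  F x *m P v x + P v x *m F x = G x *m (hv v x)^T *m xi x + G x *m (xi x)^T *m hv v x.
Proof.
move=> Ux; have cF := cov_F v Ux; have cx := cov_xi v Ux; have cGx := cov_GxiT v Ux.
have cF' := cF; rewrite -{1}(opprK (Cv v x)) in cF'.
have c1 := cov_derivM (k := Cv v x) cF cF.
rewrite -oppr0 in cx.
have c2 := cov_derivD (cov_deriv_cst _ _ _ _ (- 1%:M)) (cov_derivM cGx cx).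
rewrite addrC; apply: eq_cov_deriv Ux F2 c1 _.
by move: c2; rewrite mulmxN !mulNmx mul1mx mulmx1 opprK subrr add0r.
Qed.

(** Second covariant derivative. With [v] extended as a constant field, the derivative of [v] along
    [u] is [v *m Cv u x]; the last term removes its contribution, as tensoriality in [v]
    requires. *)
Definition hess_endo (u v x : V) : 'M[R]_d :=
  locked ('D_u (P v) x + P v x *m Cv u x - Cv u x *m P v x - P (v *m Cv u x) x).
Definition hess_vec (u v x : V) : V :=
  locked ('D_u (hv v) x + hv v x *m Cv u x - hv (v *m Cv u x) x).
(** Acts on rows from the right, whence the order of the two products; [covd_curvature] identifies
    it with the curvature of constant fields. *)
Definition curv (u v x : V) : 'M[R]_d :=
  locked ('D_u (Cv v) x - 'D_v (Cv u) x + Cv v x *m Cv u x - Cv u x *m Cv v x).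

Lemma differentiable_P v x : U x -> differentiable (P v) x.
Proof.
move=> Ux; rewrite nabla_endoE; apply: (@differentiableB _ _ _ (fun x => 'D_v F x + F x *m Cv v x) (fun x => Cv v x *m F x)).
  apply: (@differentiableD _ _ _ ('D_v F) (fun x => F x *m Cv v x)); first exact: d2F.
  by apply: differentiable_mulmx; [exact: dF|exact: differentiable_Cv].
by apply: differentiable_mulmx; [exact: differentiable_Cv|exact: dF].
Qed.

Lemma differentiable_hv v x : U x -> differentiable (hv v) x.
Proof.
move=> Ux; rewrite nabla_vecE; apply: (@differentiableD _ _ _ ('D_v xi) (fun x => xi x *m Cv v x)); first exact: d2xi.
by apply: differentiable_mulmx; [exact: dxi|exact: differentiable_Cv].
Qed.

Lemma cov_P x u v : U x ->
  cov_deriv (- Cv u x) (Cv u x) (P v) x u (hess_endo u v x + P (v *m Cv u x) x).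
Proof.
by move=> Ux; split; [exact: differentiable_P|rewrite /hess_endo -lock subrK mulNmx addrAC].
Qed.

Lemma cov_hv x u v : U x ->
  cov_deriv (0 : 'M[R]_1) (Cv u x) (hv v) x u (hess_vec u v x + hv (v *m Cv u x) x).
Proof.
by move=> Ux; split; [exact: differentiable_hv|rewrite /hess_vec -lock subrK mul0mx addr0].
Qed.

Lemma hess_endo_skew x z v w : U x -> v *m hess_endo z w x = - (w *m hess_endo z v x).
Proof.
move=> Ux.
have c a b : cov_deriv (0 : 'M[R]_1) (Cv z x) (fun y => a *m P b y) x z
    (a *m Cv z x *m P b x + a *m (hess_endo z b x + P (b *m Cv z x) x)).
  have := cov_derivM (cov_deriv_cst x z (0 : 'M[R]_1) (Cv z x) a) (cov_P z b Ux).
  by rewrite mul0mx add0r.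
have := eq_cov_deriv Ux (fun y Uy => nc_skew v w Uy) (c v w) (cov_derivN (c w v)).
rewrite !mulmxDr (nc_skew v (w *m Cv z x)) // (nc_skew w (v *m Cv z x)) //.
move=> /matrixP e; apply/matrixP => i j; have := e i j; rewrite ?(addmxE, oppmxE); lra.
Qed.

Lemma hess_endo_G x u v : U x -> hess_endo u v x *m G x + G x *m (hess_endo u v x)^T = 0.
Proof.
move=> Ux; have cP := cov_P u v Ux; have cG := cov_G u Ux.
have c1 := cov_derivM cP cG.
have cT := cov_derivT cP; rewrite linearN /= -[in X in cov_deriv X](opprK (Cv u x)^T) in cT.
have c2 := cov_derivM cG cT.
have := eq_cov_deriv Ux (fun y Uy => nabla_endo_skew v Uy) (cov_derivD c1 c2) (cov_deriv0 _ _ _ _).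
rewrite mulmx0 addr0 mul0mx add0r linearD /= mulmxDl mulmxDr addrACA.
by rewrite nabla_endo_skew // addr0.
Qed.

Lemma hess_endo_F x u v : U x ->
  hess_endo u v x *m F x + P v x *m P u x + P u x *m P v x + F x *m hess_endo u v x =
  G x *m (hess_vec u v x)^T *m xi x + G x *m (hv v x)^T *m hv u x +
  G x *m (hv u x)^T *m hv v x + G x *m (xi x)^T *m hess_vec u v x.
Proof.
move=> Ux; have cP := cov_P u v Ux; have cF := cov_F u Ux; have cG := cov_G u Ux.
have ch := cov_hv u v Ux; have cx := cov_xi u Ux.
have cFP := cov_derivD (cov_derivM (k := Cv u x) cF cP) (cov_derivM (k := Cv u x) cP cF).
have chT := cov_derivT ch; rewrite -(opprK (Cv u x)^T) trmx0 in chT.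
have cGhT := cov_derivM cG chT; have cGxT := cov_GxiT u Ux.
rewrite -oppr0 in cx ch.
have := eq_cov_deriv Ux (fun y Uy => nabla_endo_F v Uy) cFP
  (cov_derivD (cov_derivM cGhT cx) (cov_derivM cGxT ch)).
have := nabla_endo_F (v *m Cv u x) Ux.
have -> : (hess_vec u v x + hv (v *m Cv u x) x)^T = (hess_vec u v x)^T + (hv (v *m Cv u x) x)^T.
  by rewrite linearD.
rewrite mul0mx add0r ![_ *m (_ + _)]mulmxDr ![(_ + _) *m _]mulmxDl.
move=> /matrixP e1 /matrixP e2; apply/matrixP => i j; have := e1 i j; have := e2 i j.
rewrite ?(addmxE, oppmxE). lra.
Qed.

(** Schwarz's theorem cancels the second derivatives of [F], and the symmetry [Csym] cancels the
    correction terms of the two Hessians. *)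
Lemma ricci_endo x u v : U x ->
  hess_endo u v x - hess_endo v u x = F x *m curv u v x - curv u v x *m F x.
Proof.
move=> Ux.
have dP a b : 'D_a (P b) x = 'D_a ('D_b F) x + ('D_a F x *m Cv b x + F x *m 'D_a (Cv b) x)
    - ('D_a (Cv b) x *m F x + Cv b x *m 'D_a F x).
  have d1 := dF Ux; have d2 := d2F b Ux; have d3 := differentiable_Cv b Ux.
  have d4 := differentiable_mulmx d1 d3; have d5 := differentiable_mulmx d3 d1.
  rewrite nabla_endoE.
  have d6 := differentiableD d2 d4.
  apply: (etrans (@derive_fun_sub _ _ _ (fun x => 'D_b F x + F x *m Cv b x) _ x a d6 d5)).
  congr (_ - _); last exact: derive_mulmx.
  apply: (etrans (derive_fun_add a d2 d4)).
  by congr (_ + _); exact: derive_mulmx.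
rewrite /hess_endo /curv -!lock !dP (Csym u v Ux) (schwarz_mx v u oU Ux dF d2F) !nabla_endoE.
move: ('D_v ('D_u F) x) ('D_u F x) ('D_v F x) ('D_u (Cv v) x) ('D_v (Cv u) x) (F x) (Cv u x) (Cv v x) => a b c e f k l m.
rewrite ?(mulmxDl, mulmxDr, mulmxN, mulNmx, mulmxA).
by apply/matrixP => i j; rewrite ?(addmxE, oppmxE); ring.
Qed.

(** Differentiating [metric] writes ['D_u ('D_v G)] through the connection; its symmetry in [u] and
    [v] is the claim. *)
Lemma curv_G x u v : U x -> curv u v x *m G x + G x *m (curv u v x)^T = 0.
Proof.
move=> Ux.
have dG' b y : U y -> differentiable (fun y => Cv b y *m G y) y /\
   differentiable (fun y => G y *m (Cv b y)^T) y.
  move=> Uy; have d1 := dG Uy; have d3 := differentiable_Cv b Uy.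
  by split; apply: differentiable_mulmx => //; exact: differentiable_trmx.
have D2 a b : 'D_a ('D_b G) x =
   ('D_a (Cv b) x *m G x + Cv b x *m (Cv a x *m G x + G x *m (Cv a x)^T)) +
   ((Cv a x *m G x + G x *m (Cv a x)^T) *m (Cv b x)^T + G x *m ('D_a (Cv b) x)^T).
  apply: (etrans (near_eq_derive a (near_open oU Ux (fun y Uy => metric b Uy)))).
  rewrite -(metric a Ux); have [d4 d5] := dG' b x Ux.
  have d1 := dG Ux; have d3 := differentiable_Cv b Ux.
  apply: (etrans (derive_fun_add a d4 d5)).
  congr (_ + _); first exact: derive_mulmx.
  apply: (etrans (derive_mulmx _ _ _)) => //; first exact: differentiable_trmx.
  by congr (_ + _ *m _); exact: derive_trmx.
have := etrans (esym (D2 u v)) (etrans (schwarz_mx v u oU Ux dG d2G) (D2 v u)).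
rewrite /curv -lock.
move: ('D_u (Cv v) x) ('D_v (Cv u) x) (G x) (Cv u x) (Cv v x) => e f k l m.
have -> : (e - f + m *m l - l *m m)^T = e^T - f^T + l^T *m m^T - m^T *m l^T.
  by rewrite !linearD /= !linearN /= !trmx_mul.
rewrite ?(mulmxDl, mulmxDr, mulmxN, mulNmx, mulmxA).
move=> /matrixP h; apply/matrixP => i j; have := h i j; rewrite ?(addmxE, oppmxE, zeromxE); lra.
Qed.

Lemma bianchi x u v w : U x -> w *m curv u v x + u *m curv v w x + v *m curv w u x = 0.
Proof.
move=> Ux.
have D a b c : b *m 'D_a (Cv c) x = c *m 'D_a (Cv b) x.
  have E p q : 'D_a (fun y => p *m Cv q y) x = p *m 'D_a (Cv q) x.
    apply: (etrans (derive_mulmx _ (differentiable_cst p x) (differentiable_Cv q Ux))).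
    by rewrite derive_cst mul0mx add0r.
  rewrite -!E; apply: near_eq_derive; apply: (near_open oU Ux) => y Uy; exact: Csym.
rewrite /curv -!lock.
have := D u w v; have := D v w u; have := D w v u.
have C2 a b c : a *m Cv b x *m Cv c x = b *m Cv a x *m Cv c x by rewrite (Csym a b Ux).
have := C2 w v u; have := C2 w u v; have := C2 u v w.
move: ('D_u (Cv v) x) ('D_u (Cv w) x) ('D_v (Cv w) x) ('D_v (Cv u) x) ('D_w (Cv u) x) ('D_w (Cv v) x) (Cv u x) (Cv v x) (Cv w x) => a b c e f k l m n.
rewrite ?(mulmxDl, mulmxDr, mulmxN, mulNmx, mulmxA).
move=> /matrixP h1 /matrixP h2 /matrixP h3 /matrixP h4 /matrixP h5 /matrixP h6; apply/matrixP => i j.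
have := h1 i j; have := h2 i j; have := h3 i j; have := h4 i j; have := h5 i j; have := h6 i j.
rewrite ?(addmxE, oppmxE, zeromxE); lra.
Qed.

(** * From the chart to the algebra at a point *)

Section AtPoint.
Variables (x : V) (Ux : U x).
Hypothesis gpos : forall u, u != 0 -> 0 < bil (G x) u u.
Hypothesis gxi : bil (G x) (xi x) (xi x) = 1.
Hypothesis Fxi : xi x *m F x = 0.

Local Notation g := (bil (G x)).

Lemma bilC u v : g u v = g v u.
Proof.
have e : (u *m G x *m v^T)^T = v *m G x *m u^T by rewrite !trmx_mul trmxK Gsym // mulmxA.
by rewrite /bil -e [RHS]mxE.
Qed.

Lemma bil_skew (A : 'M[R]_d) (u v : V) : A *m G x + G x *m A^T = 0 -> g (u *m A) v = - g u (v *m A).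
Proof.
move=> /eqP; rewrite addr_eq0 => /eqP e.
by rewrite /bil trmx_mul -!mulmxA (mulmxA A) e mulNmx mulmxN mxE !mulmxA.
Qed.

Variable c : R.
Hypothesis nondeg : forall z, g z (xi x) = 0 -> (forall b, g b (hv z x) = g z (hv b x)) -> z = 0.
Hypothesis sec : forall u v, g u (xi x) = 0 -> g v (xi x) = 0 ->
  g (v *m curv u v x) u = c * (g u u * g v v - g u v ^+ 2).

Lemma linear_fun_surj (f : V -> V) : linear f -> (forall z, f z = 0 -> z = 0) ->
  forall z, exists w, f w = z.
Proof.
move=> lf inj z.
pose fl : {linear V -> V} := HB.pack f (GRing.isLinear.Build _ _ _ _ _ lf).
have E w : w *m lin1_mx fl = f w by rewrite mul_rV_lin1.
have u : lin1_mx fl \in unitmx.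
  rewrite -row_free_unit -kermx_eq0; apply/eqP/row_matrixP => k; rewrite row0.
  apply: inj; rewrite -E; apply/sub_kermxP; exact: row_sub.
by exists (z *m invmx (lin1_mx fl)); rewrite -E mulmxKV.
Qed.

(** Two injective linear maps: u to the family of the g(u, e_i), giving d <= k, and w to the
    combination of the e_i with coefficients w, giving k <= d. *)
Lemma orthogonal_frame_card k (e : 'I_k -> V) : (forall i, e i != 0) ->
  (forall i j, i != j -> g (e i) (e j) = 0) ->
  (forall y, (forall i, g y (e i) = 0) -> y = 0) -> d = k.
Proof.
move=> e0 eo ey; pose B := \matrix_i e i.
have free m n (A : 'M[R]_(m, n)) : (forall w : 'rV_m, w *m A = 0 -> w = 0) -> (m <= n)%N.
  move=> H; have : row_free A.
    rewrite -kermx_eq0; apply/eqP/row_matrixP => i; rewrite row0.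
    by apply: H; apply/sub_kermxP; exact: row_sub.
  by rewrite /row_free => /eqP <-; exact: rank_leq_col.
have gB u i : (u *m (G x *m B^T)) 0 i = g u (e i).
  rewrite /bil mulmxA !mxE; apply: eq_bigr => j _; rewrite !mxE; congr (_ * _).
apply/eqP; rewrite eqn_leq; apply/andP; split.
  apply: (@free _ _ (G x *m B^T)) => w hw; apply: ey => i.
  by rewrite -gB hw mxE.
apply: (@free _ _ B) => w hw; apply/rowP => i; rewrite mxE.
have : g (w *m B) (e i) = w 0 i * g (e i) (e i).
  rewrite /bil (mulmx_sum_row w) !mulmx_suml summxE (bigD1 i) //= big1 => [|j ji].
    by rewrite addr0 rowK -!scalemxAl mxE.
  by rewrite rowK -!scalemxAl mxE -/(bil _ _ _) eo // mulr0.
rewrite hw /bil !mul0mx mxE => /esym/eqP; rewrite mulf_eq0 => /orP[/eqP//|].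
by rewrite gt_eqF // gpos.
Qed.

Lemma curv_linearl (v w z y : V) : z *m curv (v + w) y x = z *m curv v y x + z *m curv w y x.
Proof.
have a : 'D_(v + w) (Cv y) x = 'D_v (Cv y) x + 'D_w (Cv y) x.
  by have := derive_dir_linear (differentiable_Cv y Ux) 1 v w; rewrite !scale1r.
have b p q : Cv (p + q) = fun y => Cv p y + Cv q y.
  by apply/funext => t; have := Cv_linear t 1 p q; rewrite !scale1r.
have e : 'D_y (Cv (v + w)) x = 'D_y (Cv v) x + 'D_y (Cv w) x.
  by rewrite b; apply: derive_fun_add; exact: differentiable_Cv.
rewrite /curv -!lock a e b -mulmxDr; congr (_ *m _).
move: ('D_v (Cv y) x) ('D_w (Cv y) x) ('D_y (Cv v) x) ('D_y (Cv w) x) => p q r s.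
mx_linear.
Qed.

Lemma curv_alt (v w : V) : curv v w x = - curv w v x.
Proof.
rewrite /curv -!lock; move: ('D_v (Cv w) x) ('D_w (Cv v) x) => p q; mx_linear.
Qed.

Lemma constant_curvature_dim5 y : y != 0 -> g y (xi x) = 0 -> 0 < c /\ d = 5%N.
Proof.
move=> y0 hy.
(* [h1] to [h9] are the hypotheses of the pointwise algebra, with [ph u] read as [u *m F x], [P u v]
   as [v *m P u x], [H z u v] as [v *m hess_endo z u x] and [Rm u v z] as [z *m curv u v x]. *)
have Fl : linear (fun u : V => u *m F x) by move=> a u v; rewrite mulmxDl -scalemxAl.
have h1 : forall u, (u *m F x) *m F x = - u + g u (xi x) *: xi x.
  by move=> u; rewrite bil_scale -mulmxA F2 // mulmxDr mulmxN mulmx1.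
have h2 u v : g (u *m F x) v = - g u (v *m F x).
  by apply: bil_skew; rewrite FG // addNr.
have h3 u v z : g (v *m P u x) z = - g v (z *m P u x).
  by apply: bil_skew; exact: nabla_endo_skew.
have h4 u v : (v *m F x) *m P u x + (v *m P u x) *m F x =
    g (hv u x) v *: xi x + g v (xi x) *: hv u x.
  by rewrite -!mulmxA -mulmxDr nabla_endo_F // mulmxDr !mulmxA (bilC (hv u x)) !bil_scale !mulmxA.
have h5 z u v : v *m hess_endo z u x = - (u *m hess_endo z v x) by exact: hess_endo_skew.
have h6 z u v w : g (v *m hess_endo z u x) w = - g v (w *m hess_endo z u x).
  by apply: bil_skew; exact: hess_endo_G.
have h7 u v z w : g (z *m curv u v x) w = - g z (w *m curv u v x).
  by apply: bil_skew; exact: curv_G.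
have h8 u v (w : V) : w *m hess_endo u v x - w *m hess_endo v u x =
    (w *m F x) *m curv u v x - (w *m curv u v x) *m F x.
  by rewrite -!mulmxA -!mulmxBr ricci_endo.
have h9 z u v : (v *m F x) *m hess_endo z u x + (v *m P z x) *m P u x +
    (v *m P u x) *m P z x + (v *m hess_endo z u x) *m F x =
    g (hess_vec z u x) v *: xi x + g (hv u x) v *: hv z x + g (hv z x) v *: hv u x +
    g v (xi x) *: hess_vec z u x.
  have e := congr1 (mulmx v) (hess_endo_F z u Ux); rewrite !mulmxDr !mulmxA in e.
  rewrite (bilC (hess_vec z u x)) !(bilC (hv _ _) v) !bil_scale !mulmxA -e.
  by apply/matrixP => i j; rewrite ?addmxE; ring.
have surj : (forall z, hv z x + g z (xi x) *: xi x = 0 -> z = 0) ->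
    forall z, exists w, hv w x + g w (xi x) *: xi x = z.
  apply: linear_fun_surj => a u v.
  rewrite nabla_vec_linear // bilDl bilZl; apply/matrixP => i j.
  by rewrite !(addmxE, scalemxE); ring.
have F0 : 0 *m F x = 0 :> V by rewrite mul0mx.
have N (A : 'M[R]_d) (u : V) : - u *m A = - (u *m A) by rewrite mulNmx.
have sk := @h_skew R V g (bilDl (G x)) (bilZl (G x)) bilC gpos (fun u => u *m F x) (hv^~ x) (xi x)
  F0 (N (F x)) h1 Fxi gxi h2 (fun u v => v *m P u x) (fun u => mul0mx _ _)
  (fun u v => nc_skew v u Ux) h3 h4.
(* [nondeg] speaks of d eta, the alternation of g(h z, b); if [h z = 0], skewness of [h] makes both
   of its terms vanish. *)
have hinj z : g z (xi x) = 0 -> hv z x = 0 -> z = 0.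
  move=> hz h0; apply: nondeg => // b.
  by rewrite -[RHS]opprK -sk h0 bilC /bil !mul0mx mxE oppr0.
have RC u v (z : V) : z *m curv u v x = - (z *m curv v u x) by rewrite curv_alt mulmxN.
have RB u v z : z *m curv u v x + u *m curv v z x + v *m curv z u x = 0 by exact: bianchi.
have cur := @curvature_gt0 R V g (bilDl (G x)) (bilZl (G x)) bilC gpos (fun u => u *m F x) (hv^~ x) (xi x)
  F0 (N (F x)) h1 Fxi gxi h2
  (fun u v => v *m P u x) (fun u => mul0mx _ _) (fun u v => nc_skew v u Ux) h3 h4
  (fun z u v => v *m hess_endo z u x) (fun z u => hess_vec z u x) (fun u v z => z *m curv u v x)
  h5 (fun u v w z => curv_linearl u v z w) RC h7 RB h8 h9 c sec hinj y hy y0.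
have [e0 eo ey] := @orthogonal_frame R V g (bilDl (G x)) (bilZl (G x)) bilC gpos (fun u => u *m F x) (hv^~ x) (xi x)
  F0 (N (F x)) h1 Fxi gxi h2
  (fun u v => v *m P u x) (fun u => mul0mx _ _) (fun u => N (P u x)) (fun u v => nc_skew v u Ux) h3 h4
  (fun z u v => v *m hess_endo z u x) (fun z u => hess_vec z u x) (fun u v z => z *m curv u v x)
  h5 h6 (fun z u => mul0mx _ _) (fun u v => mul0mx _ _) (fun u v w z => curv_linearl u v z w)
  RC h7 RB h8 h9 c sec hinj surj y hy y0.
by split => //; exact: orthogonal_frame_card e0 eo ey.
Qed.

End AtPoint.
End ChartGeometry.

(** * Almost contact metric manifolds *)

Section BilinearAlgebra.
Context {R : realType} {d : nat}.
Notation V := 'rV[R]_d.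

Variables (F G : 'M[R]_d) (w z : V).
Hypothesis phi2 : forall u, u *m F *m F = - u + app w u *: z.
Hypothesis wz : app w z = 1.
Hypothesis compat : forall u v, bil G (u *m F) (v *m F) = bil G u v - app w u * app w v.

Let appD u v : app w (u + v) = app w u + app w v.
Proof. by rewrite /app mulmxDl mxE. Qed.
Let appZ a u : app w (a *: u) = a * app w u.
Proof. by rewrite /app -scalemxAl mxE. Qed.

(** [phi2] gives phi^2 xi = 0; applied to phi xi it shows that phi xi is a multiple of xi, and a
    nonzero factor would contradict phi^2 xi = 0 unless phi xi vanishes. *)
Lemma acm_Fz : z *m F = 0.
Proof.
have h1 : z *m F *m F = 0 by rewrite phi2 wz scale1r addNr.
have h2 : z *m F = app w (z *m F) *: z.
  by have := phi2 (z *m F); rewrite h1 mul0mx addrC => /esym/eqP; rewrite subr_eq0 => /eqP.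
have := h1; rewrite {1}h2 -scalemxAl => /eqP; rewrite scaler_eq0 => /orP[/eqP e|/eqP//].
by rewrite h2 e scale0r.
Qed.

Lemma acm_wF u : app w (u *m F) = 0.
Proof.
have h := phi2 (u *m F).
rewrite (phi2 u) mulmxDl mulNmx -scalemxAl acm_Fz scaler0 addr0 in h.
have := congr1 (app w) h; rewrite appD appZ wz mulr1 => /eqP.
by rewrite -subr_eq0 opprD addrA subrr sub0r oppr_eq0 => /eqP.
Qed.

Lemma acm_eta u : app w u = bil G u z.
Proof.
have := compat u z; rewrite acm_Fz wz mulr1 /bil trmx0 mulmx0 mxE => /esym/eqP.
by rewrite subr_eq0 => /eqP ->.
Qed.

Lemma acm_etaT : w^T = G *m z^T.
Proof.
apply/colP => a; have := acm_eta (delta_mx 0 a).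
by rewrite /app /bil -mulmxA -!rowE [LHS]mxE [RHS]mxE.
Qed.

Lemma acm_F2 : F *m F = - 1%:M + G *m z^T *m z.
Proof.
apply/row_matrixP => a; rewrite !rowE mulmxA phi2 appE acm_etaT mulmxDr mulmxN mulmx1.
by rewrite !mulmxA.
Qed.

Lemma acm_FG : F *m G = - (G *m F^T).
Proof.
have sk u v : bil G (u *m F) v = - bil G u (v *m F).
  have := compat u (v *m F); rewrite acm_wF mulr0 subr0 phi2 bilDr bilZr -acm_eta acm_wF mulr0 addr0.
  by rewrite -scaleN1r bilZr mulN1r => <-; rewrite opprK.
apply/matrixP => a b; rewrite [RHS]mxE -!bil_delta.
have := sk (delta_mx 0 a) (delta_mx 0 b).
by rewrite /bil trmx_mul !mulmxA.
Qed.

End BilinearAlgebra.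

(** * The connection matrices of a Levi-Civita connection *)

Section LeviCivita.
Context {R : realType} {d : nat} {M : topologicalType}.
Variables (A : smooth_manifold R d M) (g : riemannian_metric A).
Variable nabla : chart_index A -> @coefficients R d.
Hypothesis hLC : levi_civita g nabla.
Variable i : chart_index A.
Local Notation U := (cimg (A i)).
Local Notation V := 'rV[R]_d.
Local Notation Cv := (connection (nabla i)).

Let oU : open U := cimg_open (A i).

Lemma smooth_cst (v : V) : smooth U (cst v).
Proof. by move=> k; exact: Ck_cst. Qed.

Lemma covd_cst (v w : V) x : covd (nabla i) (cst v) (cst w) x = w *m Cv v x.
Proof.
rewrite /covd derive_cst add0r /connection mulmx_sumr; apply: eq_bigr => a _.
by rewrite -scalemxAr.
Qed.

Lemma connection_sym x u v : U x -> u *m Cv v x = v *m Cv u x.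
Proof.
move=> Ux; have := lc_torsion hLC (smooth_cst u) (smooth_cst v) Ux.
by rewrite !covd_cst /lie_bracket !derive_cst subrr => /eqP; rewrite subr_eq0 => /eqP ->.
Qed.

Lemma connection_metric x v : U x ->
  'D_v (g i) x = Cv v x *m g i x + g i x *m (Cv v x)^T.
Proof.
move=> Ux; have [dg _] := @rm_smooth _ _ _ _ g i 1%N.
apply/matrixP => a b; have := lc_metric hLC (smooth_cst v) (smooth_cst (delta_mx 0 a)) (smooth_cst (delta_mx 0 b)) Ux.
rewrite !covd_cst [X in 'D_ _ X _](_ : _ = fun y => g i y a b); last first.
  by apply/funext => y; rewrite bil_delta.
rewrite /= -(derive_entry v a b (dg x Ux)) => ->.
rewrite [RHS]mxE -!bil_delta; congr (_ + _); first by rewrite /bil !mulmxA.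
by rewrite /bil trmx_mul !mulmxA.
Qed.

Lemma connection_delta a x : Cv (delta_mx 0 a) x = nabla i x a.
Proof.
rewrite /connection (bigD1 a) //= big1 => [|b ba]; first by rewrite mxE !eqxx scale1r addr0.
by rewrite mxE eqxx (negbTE ba) scale0r.
Qed.

(** Koszul's formula, after lowering the index with [g]. Its purpose is regularity: it makes the
    given coefficients differentiable. *)
Lemma nabla_christoffel x a : U x -> nabla i x a = christoffel g i x a.
Proof.
move=> Ux; have gu := g_unit g Ux; rewrite /christoffel.
have D k b c : 'D_(delta_mx 0 k) (g i) x b c =
    (nabla i x k *m g i x) b c + (nabla i x k *m g i x) c b.
  rewrite (connection_metric (delta_mx 0 k) Ux) connection_delta addmxE; congr (_ + _).
  by rewrite -[in LHS](g_tr g Ux) -trmx_mul mxE.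
have S b c l : (nabla i x b *m g i x) c l = (nabla i x c *m g i x) b l.
  have := connection_sym (delta_mx 0 c) (delta_mx 0 b) Ux; rewrite !connection_delta.
  move=> /(congr1 (mulmx^~ (g i x))); rewrite -!mulmxA -!rowE => /rowP/(_ l).
  by rewrite mxE [RHS]mxE.
rewrite -[LHS](mulmxK gu); congr (_ *m _); apply/matrixP => b l.
rewrite [RHS]mxE [X in _ * X]mxE.
pose K k p q := (nabla i x k *m g i x) p q + (nabla i x k *m g i x) q p.
transitivity (2^-1 * (K a b l + K b a l - K l a b)).
  by rewrite /K (S a b l) (S a l b) (S b l a); lra.
by congr (_ * (_ + _ - _)); symmetry; exact: D.
Qed.

Lemma differentiable_nabla a x : U x -> differentiable ((nabla i)^~ a) x.
Proof.
move=> Ux; have [dg Dg] := @rm_smooth _ _ _ _ g i 2%N.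
apply: (near_eq_differentiable (f := (christoffel g i)^~ a)).
  by apply: (near_open oU Ux) => y Uy; rewrite nabla_christoffel.
apply: differentiable_mulmx; last first.
  apply: differentiable_invmx (dg x Ux); near=> y; apply: g_unit; near: y.
  exact: open_nbhs_nbhs.
apply: differentiable_mx => b l; under eq_fun do rewrite !mxE.
have e v p q : differentiable (fun y => 'D_v (g i) y p q) x.
  by apply: diff_entry; have [H _] := Dg v; exact: H.
apply: (@differentiableM _ _ (cst 2^-1)); first exact: differentiable_cst.
apply: (@differentiableB _ _ _ (fun y => 'D_(delta_mx 0 a) (g i) y b l + 'D_(delta_mx 0 b) (g i) y a l)); last exact: e.
by apply: (@differentiableD _ _ _ (fun y => 'D_(delta_mx 0 a) (g i) y b l)); exact: e.
Unshelve. all: by end_near. Qed.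

Lemma covd_curvature (u v w : V) x : U x ->
  curvature (nabla i) (cst u) (cst v) (cst w) x = w *m curv (nabla i) u v x.
Proof.
move=> Ux; have c2 a b : covd (nabla i) (cst a) (covd (nabla i) (cst b) (cst w)) x =
    w *m 'D_a (Cv b) x + w *m Cv b x *m Cv a x.
  have -> : covd (nabla i) (cst b) (cst w) = fun y => w *m Cv b y.
    by apply/funext => y; rewrite covd_cst.
  rewrite /covd (derive_mulmx _ (differentiable_cst w x) (differentiable_Cv differentiable_nabla b Ux)).
  rewrite derive_cst mul0mx add0r; congr (_ + _).
  rewrite /connection [in RHS]mulmx_sumr; apply: eq_bigr => k _.
  by rewrite -scalemxAr.
rewrite /curvature (_ : lie_bracket (cst u) (cst v) = cst (0 : V)); last first.
  by apply/funext => y; rewrite /lie_bracket !derive_cst subrr.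
rewrite !c2 covd_cst /curv -lock.
have -> : Cv (0 : V) x = 0.
  by rewrite /connection big1 // => a _; rewrite mxE scale0r.
move: ('D_u (Cv v) x) ('D_v (Cv u) x) => p q.
rewrite mulmx0 subr0 ?(mulmxDr, mulmxN, mulmxA).
by apply/matrixP => a b; rewrite ?(addmxE, oppmxE); ring.
Qed.

End LeviCivita.

Section NearlyCosymplectic.
Context {R : realType} {d : nat} {M : topologicalType}.
Variables (A : smooth_manifold R d M).
Variables (nabla : chart_index A -> @coefficients R d) (phi : tensor11 A).
Hypothesis hnc : nearly_cosymplectic nabla phi.

Lemma nearly_cosymplectic_pointwise i x (u : 'rV[R]_d) : cimg (A i) x ->
  u *m nabla_endo (phi i) (nabla i) u x = 0.
Proof.
move=> Ux; have [X [b b0 Xb]] := exists_vector_field Ux u.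
have dX : differentiable (X i) x by have [H _] := @vf_smooth _ _ _ _ X i 1%N; exact: H.
have dp y : cimg (A i) y -> differentiable (phi i) y.
  by have [H _] := @t11_smooth _ _ _ _ phi i 1%N; exact: H.
have := hnc X Ux; rewrite /covd_endo /covd (derive_mulmx _ dX (dp x Ux)).
have e (w : 'rV[R]_d) : \sum_a X i x 0 a *: (w *m nabla i x a) = w *m connection (nabla i) (X i x) x.
  by rewrite /connection mulmx_sumr; apply: eq_bigr => a _; rewrite -scalemxAr.
rewrite !e; have P := nabla_endoE (phi i) (nabla i) (X i x).
have : X i x *m nabla_endo (phi i) (nabla i) (X i x) x = X i x *m 'D_(X i x) (phi i) x +
    X i x *m phi i x *m connection (nabla i) (X i x) x -
    X i x *m connection (nabla i) (X i x) x *m phi i x.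
  by rewrite P; move: ('D_(X i x) (phi i) x) => q; rewrite mulmxBr mulmxDr !mulmxA.
move: ('D_(X i x) (phi i) x) ('D_(X i x) (X i) x) => q s Pe.
(* The derivative [s] of the field itself cancels, which is the tensoriality of the identity. *)
have E : s *m phi i x + X i x *m q + X i x *m phi i x *m connection (nabla i) (X i x) x -
    (s + X i x *m connection (nabla i) (X i x) x) *m phi i x =
    X i x *m nabla_endo (phi i) (nabla i) (X i x) x.
  by rewrite Pe mulmxDl; apply/matrixP => k l; rewrite ?(addmxE, oppmxE); ring.
rewrite E Xb => /eqP.
have lP := nabla_endo_linear (nabla i) dp Ux.
have -> : nabla_endo (phi i) (nabla i) (b *: u) x = b *: nabla_endo (phi i) (nabla i) u x.
  have z0 : nabla_endo (phi i) (nabla i) 0 x = 0.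
    by have := lP (-1) 0 0; rewrite scaler0 addr0 scaleN1r addNr.
  by have := lP b u 0; rewrite !addr0 z0 addr0.
by rewrite -scalemxAr -scalemxAl !scaler_eq0 (gt_eqF b0) /= => /eqP.
Qed.

End NearlyCosymplectic.

Section SectionalCurvature.
Context {R : realType} {d : nat} {M : topologicalType}.
Variables (A : smooth_manifold R d M) (g : riemannian_metric A).
Variables (nabla : chart_index A -> @coefficients R d) (hLC : levi_civita g nabla).
Variables (eta : one_form A) (p : M) (c : R) (hK : sectional_on_ker g nabla eta p c).
Variables (i : chart_index A) (hp : cdom (A i) p).
Local Notation x := (cfun (A i) p).
Local Notation b := (bil (g i x)).

(** The assumption is a quotient on independent pairs. For dependent pairs both sides vanish; for
    independent ones the denominator is |v|^2 |w|^2 > 0, with [w] the part of [u] orthogonal to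
    [v]. *)
Lemma sectional_curv (u v : 'rV[R]_d) : app (eta i x) u = 0 -> app (eta i x) v = 0 ->
  b (v *m curv (nabla i) u v x) u = c * (b u u * b v v - b u v ^+ 2).
Proof.
move=> hu hv; have Ux : cimg (A i) x by exact: cfun_img.
have bC s t : b s t = b t s by exact: rm_sym.
have b0 s : b 0 s = 0 by rewrite /bil !mul0mx mxE.
have [dg Dg] := @rm_smooth _ _ _ _ g i 2%N.
have cG : curv (nabla i) u v x *m g i x + g i x *m (curv (nabla i) u v x)^T = 0.
  apply: (curv_G (U := cimg (A i))) => //.
  - exact: cimg_open.
  - by move=> w y Uy; have [H _] := Dg w; exact: H.
  - exact: differentiable_nabla hLC i.
  - by move=> y w Uy; exact: connection_metric.
have [->|v0] := eqVneq v 0.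
  by rewrite mul0mx b0 (bC u) !b0; ring.
have [/vlineP[k e]|uv] := boolP (u \in <[v]>%VS).
  have hz : b (v *m curv (nabla i) u v x) v = 0.
    by have := bil_skew v v cG; rewrite (bC v (v *m _)); lra.
  have -> : b (v *m curv (nabla i) u v x) u = 0.
    by move: hz; move: (v *m curv _ _ _ _) => t hz; rewrite bC e bilZl bC hz mulr0.
  have e1 : b u v = k * b v v by rewrite e bilZl.
  have e2 : b u u = k * (k * b v v) by rewrite {1}e bilZl bC e1.
  by rewrite e1 e2; ring.
have uvf : free [:: u; v] by rewrite free_cons span_seq1 uv seq1_free.
have := hK hp hu hv uvf; rewrite /sectional (covd_curvature hLC) // => /(canRL (divfK _)); apply.
pose w := u - (b u v / b v v) *: v.
have bv : 0 < b v v by exact: rm_pos.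
have w0 : w != 0.
  apply: contraNneq uv => /eqP; rewrite subr_eq0 => /eqP ->.
  by rewrite memvZ // memv_line.
have : 0 < b v v * b w w by rewrite mulr_gt0 //; exact: rm_pos.
have -> : b v v * b w w = b u u * b v v - b u v ^+ 2.
  rewrite /w -scaleNr bilDl bilZl (bC u) (bC v) !bilDl !bilZl (bC v u); field.
  by rewrite gt_eqF.
by move/gt_eqF/negbT.
Qed.

End SectionalCurvature.

Section MainTheorem.
Variables (R : realType) (n : nat) (M : topologicalType).
Local Notation d := (2 * n).+1.
Variables (A : smooth_manifold R d M) (phi : tensor11 A) (xi : vector_field A) (eta : one_form A).
Variables (g : riemannian_metric A) (nabla : chart_index A -> @coefficients R d).
Hypothesis hcontact : contact_form n eta.
Hypothesis hacm : almost_contact_metric phi xi eta g.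
Hypothesis hLC : levi_civita g nabla.
Variable i : chart_index A.
Local Notation U := (cimg (A i)).

Lemma eta_metric x : U x -> (eta i x)^T = g i x *m (xi i x)^T.
Proof.
move=> Ux; apply: acm_etaT => [u||u v].
- exact: acm_phi2 hacm _ _ _ Ux.
- exact: acm_eta_xi hacm _ _ Ux.
- exact: acm_compat hacm _ _ _ _ Ux.
Qed.

(** As eta is dual to xi, the derivative of eta(w) along v is eta(nabla_v w) + g(w, nabla_v xi) for
    constant w; the first terms cancel because there is no torsion. *)
Lemma ext_d_eta x a b : U x ->
  ext_d (eta i) x a b = bil (g i x) b (nabla_vec (xi i) (nabla i) a x) -
                        bil (g i x) a (nabla_vec (xi i) (nabla i) b x).
Proof.
move=> Ux.
have dg y : U y -> differentiable (g i) y by have [H _] := @rm_smooth _ _ _ _ g i 1%N; exact: H.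
have dx y : U y -> differentiable (xi i) y by have [H _] := @vf_smooth _ _ _ _ xi i 1%N; exact: H.
have D (v w : 'rV[R]_d) : 'D_v (fun y => app (eta i y) w) x =
    (w *m connection (nabla i) v x *m (g i x *m (xi i x)^T)) 0 0 +
    bil (g i x) w (nabla_vec (xi i) (nabla i) v x).
  have cG := cov_GxiT dg dx (fun y u Uy => connection_metric hLC u Uy) v Ux.
  have [dq q] := cov_derivM (cov_deriv_cst x v (0 : 'M[R]_1) (connection (nabla i) v x) w) cG.
  rewrite !mul0mx mulmx0 !add0r !addr0 in q.
  have e : \near x, app (eta i x) w = (w *m (g i x *m (xi i x)^T)) 0 0.
    by apply: (near_open (cimg_open (A i)) Ux) => y Uy; rewrite /app eta_metric.
  apply: (etrans (near_eq_derive v e)); apply: (etrans (esym (derive_entry v 0 0 dq))).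
  by rewrite q mxE /bil !mulmxA.
rewrite /ext_d !D (connection_sym hLC a b Ux); ring.
Qed.

(** A nonzero such [z] would annihilate both eta and d eta, hence the top-degree contact form. *)
Lemma contact_nondegenerate x z : U x -> bil (g i x) z (xi i x) = 0 ->
  (forall b, bil (g i x) b (nabla_vec (xi i) (nabla i) z x) =
             bil (g i x) z (nabla_vec (xi i) (nabla i) b x)) -> z = 0.
Proof.
move=> Ux hz hb; apply/eqP/negPn/negP => z0.
have [s /eqP] := hcontact Ux; apply.
have dx y : U y -> differentiable (xi i) y by have [H _] := @vf_smooth _ _ _ _ xi i 1%N; exact: H.
have hl := nabla_vec_linear (nabla i) dx Ux.
apply: contact_killed_eq0 z0 _ _ _ => //.
- by move=> v j t a b; rewrite !(ord1 j) /update /= /app mulmxDl -scalemxAl !mxE.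
- move=> v j t a b; rewrite !ext_d_eta //.
  case: j => [[|[|//]] j]; rewrite /update /= ?hl ?bilDl ?bilZl ?bilDr ?bilZr; ring.
- move=> v j vj; rewrite (ord1 j) in vj; rewrite vj /app eta_metric //.
  by rewrite mulmxA; exact: hz.
- move=> v; case=> [[|[|//]] j] vj; rewrite ext_d_eta //.
  + have -> : v ord0 = z by rewrite -vj; congr v; exact: val_inj.
    by rewrite hb subrr.
  + have -> : v ord_max = z by rewrite -vj; congr v; exact: val_inj.
    by rewrite hb subrr.
Qed.

End MainTheorem.

Theorem theorem3 (R : realType) (n : nat) (hn : (1 <= n)%N)
  (M : topologicalType) (A : smooth_manifold R (2 * n).+1 M)
  (phi : tensor11 A) (xi : vector_field A) (eta : one_form A)
  (g : riemannian_metric A)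
  (nabla : chart_index A -> @coefficients R (2 * n).+1)
  (hcontact : contact_form n eta)
  (hacm : almost_contact_metric phi xi eta g)
  (hLC : levi_civita g nabla)
  (hnc : nearly_cosymplectic nabla phi)
  (p : M) (c : R)
  (hK : sectional_on_ker g nabla eta p c) :
  c <> 0 /\ (2 * n).+1 = 5%N.
Proof.
have [i hp] := chart_cover A p.
have Ux := cfun_img hp; set x := cfun (A i) p in Ux.
have dF := @t11_smooth _ _ _ _ phi i 2%N.
have dG := @rm_smooth _ _ _ _ g i 2%N.
have dxi := @vf_smooth _ _ _ _ xi i 2%N.
have ph2 y Uy u := @acm_phi2 _ _ _ _ _ _ _ _ hacm i y u Uy.
have exi y Uy := @acm_eta_xi _ _ _ _ _ _ _ _ hacm i y Uy.
have cpt y Uy u v := @acm_compat _ _ _ _ _ _ _ _ hacm i y u v Uy.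
have eta_g u : app (eta i x) u = bil (g i x) u (xi i x).
  exact: acm_eta (ph2 x Ux) (exi x Ux) (cpt x Ux) u.
(* The kernel of eta has dimension at least 2n, which is positive by [hn]. *)
have [y hy y0] : exists2 y, app (eta i x) y = 0 & y != 0.
  have /rowV0Pn[y /sub_kermxP hy y0] : kermx (eta i x)^T != 0.
    rewrite -mxrank_eq0 mxrank_ker -lt0n subn_gt0; apply: leq_ltn_trans (rank_leq_col _) _.
    by rewrite ltnS muln_gt0.
  by exists y => //; rewrite /app hy mxE.
have [c0 d5] : 0 < c /\ (2 * n).+1 = 5%N.
  apply: (@constant_curvature_dim5 R _ (cimg (A i)) (cimg_open (A i)) (phi i) (g i) (xi i) (nabla i)
    _ _ _ _ _ _ _ _ _ _ _ _ _ x Ux _ _ _ c _ _ y y0).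
  - by have [H _] := dF; exact: H.
  - by move=> v z Uz; have [_ /(_ v)[H _]] := dF; exact: H.
  - by have [H _] := dG; exact: H.
  - by move=> v z Uz; have [_ /(_ v)[H _]] := dG; exact: H.
  - by have [H _] := dxi; exact: H.
  - by move=> v z Uz; have [_ /(_ v)[H _]] := dxi; exact: H.
  - exact: differentiable_nabla hLC i.
  - by move=> z u v Uz; exact: (connection_sym hLC u v Uz).
  - by move=> z v Uz; exact: (connection_metric hLC v Uz).
  - exact: g_tr.
  - by move=> z Uz; exact: acm_F2 (ph2 z Uz) (exi z Uz) (cpt z Uz).
  - by move=> z Uz; exact: acm_FG (ph2 z Uz) (exi z Uz) (cpt z Uz).
  - by move=> z u Uz; exact: nearly_cosymplectic_pointwise.
  - by move=> u u0; exact: rm_pos.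
  - by rewrite -eta_g exi.
  - exact: acm_Fz (ph2 x Ux) (exi x Ux).
  - by move=> z; exact: (contact_nondegenerate hcontact hacm hLC Ux).
  - by move=> u v; rewrite -!eta_g => hu hv; exact: (sectional_curv hLC hK hp hu hv).
  - by rewrite -eta_g.
by split => // c00; rewrite c00 ltxx in c0.
Qed.
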